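(* Let $m,n$ be positive integers, let $\mathbf A\in\mathbb R_+^{m\times n}$, $\mathbf c\in\mathbb R_+^n$, $\bar d>0$, $\mathbf d=\bar d\,\mathbf e\in\mathbb R^n_+$, and let $\mathcal U=\{\mathbf h\in\mathbb R^m_+ : \mathbf R\mathbf h\le \mathbf r\}$ with $\mathbf R\in\mathbb R_+^{L\times m}$, $\mathbf r\in\mathbb R_+^L$, be a compact polyhedral uncertainty set. Suppose the entries of the random matrix $\tilde{\mathbf B}\in\mathbb R_+^{m\times n}$ are $\tilde B_{ij}=|\tilde G_{ij}|$, where the $\tilde G_{ij}$ are i.i.d. standard Gaussian random variables. Then there is a quantity $\kappa=O\left(\sqrt{\log m+\log n}\right)$ such that for $n$ and $m$ sufficiently large, with probability at least $1-\frac1m$, $$z_{\sf AR}(\tilde{\mathbf B})\le z_{\sf Aff}(\tilde{\mathbf B})\le \kappa\cdot z_{\sf AR}(\tilde{\mathbf B}).$$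
   Context: For data $\mathbf A,\mathbf B\in\mathbb R_+^{m\times n}$, $\mathbf c,\mathbf d\in\mathbb R_+^n$ and a compact convex set $\mathcal U\subseteq\mathbb R^m_+$, the two-stage adjustable robust problem is $$z_{\sf AR}(\mathbf B)=\min_{\mathbf x\in\mathbb R^n_+}\ \mathbf c^T\mathbf x+\max_{\mathbf h\in\mathcal U}\ \min_{\mathbf y(\mathbf h)\in\mathbb R^n_+:\ \mathbf A\mathbf x+\mathbf B\mathbf y(\mathbf h)\ge \mathbf h}\ \mathbf d^T\mathbf y(\mathbf h),$$ i.e. the second-stage decision $\mathbf y(\mathbf h)$ may depend arbitrarily on $\mathbf h$. The affine policy problem $z_{\sf Aff}(\mathbf B)$ is the same problem with the second-stage decision restricted to $\mathbf y(\mathbf h)=\mathbf P\mathbf h+\mathbf q$ for some $\mathbf P\in\mathbb R^{n\times m}$, $\mathbf q\in\mathbb R^n$: it is the minimum over $\mathbf x\in\mathbb R^n_+,\mathbf P,\mathbf q$ of $\mathbf c^T\mathbf x+\max_{\mathbf h\in\mathcal U}\mathbf d^T(\mathbf P\mathbf h+\mathbf q)$ subject to $\mathbf A\mathbf x+\mathbf B(\mathbf P\mathbf h+\mathbf q)\ge\mathbf h$ and $\mathbf P\mathbf h+\mathbf q\ge\mathbf 0$ for all $\mathbf h\in\mathcal U$. Here $\mathbf e$ denotes the all-ones vector; $\mathbf A,\mathbf c,\mathbf d,\mathcal U$ are fixed and only $\mathbf B$ is random. The $O(\cdot)$ hides an absolute constant independent of $m,n$ and of the instance. *)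

(* Defs.v *)
From HB Require Import structures.
From mathcomp Require Import all_boot all_order all_algebra.
From mathcomp Require Import all_classical all_reals all_analysis.
Set Implicit Arguments. Unset Strict Implicit. Unset Printing Implicit Defensive.
Import Order.TTheory GRing.Theory Num.Theory.
Import numFieldNormedType.Exports.
Local Open Scope classical_set_scope.
Local Open Scope ring_scope.

Definition mxle {R : realType} {p q : nat} (M N : 'M[R]_(p, q)) : Prop :=
  forall i j, M i j <= N i j.

Definition mxnonneg {R : realType} {p q : nat} (M : 'M[R]_(p, q)) : Prop :=
  mxle 0 M.

Definition dotv {R : realType} {n : nat} (u v : 'cV[R]_n) : R :=
  \sum_(i < n) u i ord0 * v i ord0.

Definition onesv {R : realType} (n : nat) : 'cV[R]_n := const_mx 1.

Definition polyU {R : realType} {L m : nat} (Rm : 'M[R]_(L, m)) (r : 'cV[R]_L)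
  : set 'cV[R]_m :=
  [set h | mxnonneg h /\ mxle (Rm *m h) r].

Local Open Scope ereal_scope.

(* Optimal second-stage cost for first-stage x and realization h
   (+oo if infeasible). *)
Definition second_stage {R : realType} {m n : nat}
    (A B : 'M[R]_(m, n)) (d x : 'cV[R]_n) (h : 'cV[R]_m) : \bar R :=
  ereal_inf [set (dotv d y)%:E | y in
    [set y : 'cV[R]_n | mxnonneg y /\ mxle h (A *m x + B *m y)]].

Definition z_AR {R : realType} {m n : nat} (A B : 'M[R]_(m, n))
    (c d : 'cV[R]_n) (U : set 'cV[R]_m) : \bar R :=
  ereal_inf [set (dotv c x)%:E + ereal_sup [set second_stage A B d x h | h in U]
            | x in [set x : 'cV[R]_n | mxnonneg x]].

Definition aff_feasible {R : realType} {m n : nat} (A B : 'M[R]_(m, n))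
    (U : set 'cV[R]_m) (x : 'cV[R]_n) (P : 'M[R]_(n, m)) (q : 'cV[R]_n) : Prop :=
  mxnonneg x /\
  forall h, U h -> mxle h (A *m x + B *m (P *m h + q)) /\ mxnonneg (P *m h + q).

Definition z_Aff {R : realType} {m n : nat} (A B : 'M[R]_(m, n))
    (c d : 'cV[R]_n) (U : set 'cV[R]_m) : \bar R :=
  ereal_inf [set v | exists x P q, aff_feasible A B U x P q /\
     v = (dotv c x)%:E + ereal_sup [set (dotv d (P *m h + q))%:E | h in U]].

Definition mutually_independent {d : measure_display} {T : measurableType d}
    {R : realType} {I : finType} (P : probability T R) (X : I -> {RV P >-> R})
  : Prop :=
  forall (S : {set I}) (Bs : I -> set R),
    (forall i, measurable (Bs i)) ->
    P (\bigcap_(i in [set i | i \in S]) (X i @^-1` Bs i)) =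
    (\prod_(i in S) P (X i @^-1` Bs i))%E.

Definition absmx {d : measure_display} {T : measurableType d} {R : realType}
    {P : probability T R} {m n : nat} (G : 'I_m * 'I_n -> {RV P >-> R})
    (w : T) : 'M[R]_(m, n) :=
  \matrix_(i, j) (`|G (i, j) w|)%R.
Arguments mutually_independent {d T R I} P X.

(* Main.v *)
(** Only the maximum M_i and the mean a_i of each row of B matter.  Let u_i be the
    largest value of h_i on U.  For a first stage x and a bound s on the total second
    stage |y(h)|_1, put v_i = (u_i - (A x)_i) / s.  Feasibility forces v_i <= M_i in every
    row, while the constant policy y = kappa s / n serves every row that is not light,
    that is, every row with v_i <= kappa a_i.

    Since m may be exponentially large in n, light rows cannot be excluded; but with high
    probability there are only O(log (m n)) of them, simultaneously for all (x, s).  For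
    fixed v, a row is light with probability at most e^(-n) times the probability that
    M_i < v_i, and expanding prod_i ((1 - r_i) + r_i) = 1 with r_i = P(M_i < v_i) shows that
    all rows satisfy v_i <= M_i while K of them are light with probability at most
    e^(-n K).  The vectors v depend affinely on n + 1 parameters, so up to a factor 2 only
    (m n)^(6 n) of them have to be considered: one for each cell of the arrangement of
    hyperplanes v_i = 2^l / m.

    The k remaining light rows are served by the affine policy of Bertsimas and Goyal, which
    loses a factor O(sqrt k). *)

Require Import Defs.
From HB Require Import structures.
From mathcomp Require Import all_boot all_order all_algebra.
From mathcomp Require Import all_classical all_reals all_analysis.
From mathcomp Require Import measurable_realfun ring lra zify.
Import Order.TTheory GRing.Theory Num.Theory.
Import numFieldNormedType.Exports.
Local Open Scope classical_set_scope.
Local Open Scope ring_scope.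

Set Implicit Arguments. Unset Strict Implicit. Unset Printing Implicit Defensive.

(** * The standard normal distribution *)

Section StandardNormal.
Variable R : realType.
Local Notation gauss := (normal_prob (0 : R) 1).
Local Notation mu := (@lebesgue_measure R).

Lemma measurable_absitv (a b : R) : measurable [set x : R | a <= `|x| < b].
Proof.
have -> : [set x : R | a <= `|x| < b] = setT `&` (@Num.norm R R) @^-1` `[a, b[.
  by rewrite setTI; apply/seteqP; split => x /=; rewrite in_itv.
exact: (@normr_measurable R setT measurableT).
Qed.

Lemma measurable_absray (a : R) : measurable [set x : R | a <= `|x|].
Proof.
have -> : [set x : R | a <= `|x|] = setT `&` (@Num.norm R R) @^-1` `[a, +oo[.
  by rewrite setTI; apply/seteqP; split => x /=; rewrite in_itv/= andbT.
exact: (@normr_measurable R setT measurableT).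
Qed.

Lemma measurable_absball (a : R) : measurable [set x : R | `|x| < a].
Proof.
have -> : [set x : R | `|x| < a] = setT `&` (@Num.norm R R) @^-1` `]-oo, a[.
  by rewrite setTI; apply/seteqP; split => x /=; rewrite in_itv.
exact: (@normr_measurable R setT measurableT).
Qed.

Let mpdf (D : set (measurableTypeR R)) (s : R) :
  measurable_fun D (fun x : measurableTypeR R => (normal_pdf 0 s x)%:E).
Proof.
by apply: measurable_funTS; apply/measurable_EFinP; exact: measurable_normal_pdf.
Qed.

Let pdf_ge0 (s x : R) : (0 <= (normal_pdf 0 s x)%:E)%E.
Proof. by rewrite lee_fin normal_pdf_ge0. Qed.

(** Since [2 <= pi < 4], the number [2 * pi] lies between 4 and 8 and its square root between 2 and
    4. *)
Lemma normal_peak1_bounds : 4^-1 <= normal_peak (1 : R) <= 2^-1.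
Proof.
rewrite /normal_peak expr1n mul1r -[pi *+ 2]mulr_natr.
have := pi_ge2 R; have := pihalf_lt2 R; move: (pi : R) => p p4 p2.
have s0 : 0 < p * 2 by lra.
have r0 : 0 < Num.sqrt (p * 2) by rewrite sqrtr_gt0.
rewrite !lef_pV2 ?posrE//.
have := sqr_sqrtr (ltW s0); move: (Num.sqrt _) r0 => r r0 rE.
by apply/andP; split; nra.
Qed.

Lemma normal_prob_itv_le (a b : R) : a <= b ->
  (gauss `[a, b] <= (2^-1 * (b - a))%:E)%E.
Proof.
move=> ab; rewrite /normal_prob.
apply: (@le_trans _ _ (\int[mu]_(x in `[a, b]) (2^-1 : R)%:E)%E).
  apply: ge0_le_integral => //.
  move=> x _; rewrite lee_fin; apply: (le_trans (normal_pdf_ub _ _ (oner_neq0 _))).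
  by case/andP: normal_peak1_bounds.
rewrite integral_cst//= lebesgue_measure_itv/= lte_fin.
have [ab'|ba] := ltrP a b; first by rewrite -EFinD -EFinM.
by rewrite mule0 lee_fin mulr_ge0// subr_ge0.
Qed.

Lemma normal_prob_itv_ge (a : R) : 0 <= a <= 1 ->
  ((8^-1 * (a *+ 2))%:E <= gauss `](- a)%R, a[)%E.
Proof.
move=> /andP[a0 a1]; rewrite /normal_prob.
apply: (@le_trans _ _ (\int[mu]_(x in `](- a)%R, a[) (8^-1 : R)%:E)%E).
  rewrite integral_cst//= lebesgue_measure_itv/= lte_fin.
  have [ab'|ba] := ltrP (-a) a.
    by rewrite -EFinD -EFinM lee_fin; lra.
  by rewrite mule0 lee_fin; lra.
apply: ge0_le_integral => //.
move=> x /=; rewrite in_itv/= => /andP[x1 x2]; rewrite lee_fin.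
rewrite normal_pdfE ?oner_eq0// /normal_fun subr0 expr1n.
have /andP[h1 _] := normal_peak1_bounds.
(* From [expR y >= 1 + y] with [y >= -1/2]. *)
have h2 : 2^-1 <= expR (- x ^+ 2 / (1 *+ 2)) :> R.
  apply: le_trans (expR_ge1Dx _).
  have : x ^+ 2 <= 1 by nra.
  lra.
have -> : (8^-1 : R) = 4^-1 * 2^-1 by lra.
by apply: ler_pM => //; lra.
Qed.

Lemma normal_prob_absitv_le (a b : R) : 0 <= a <= b ->
  (gauss [set x | (a <= `|x| < b)%R] <= (b - a)%:E)%E.
Proof.
move=> /andP[a0 ab].
apply: (@le_trans _ _ (gauss (`[a, b] `|` `[(- b)%R, (- a)%R]))%E).
  apply: le_measure; rewrite ?inE; first exact: measurable_absitv.
    exact: measurableU.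
  move=> x /= /andP[]; case: (ger0P x) => x0 h1 h2; [left|right];
    rewrite /= in_itv/=; lra.
apply: (le_trans (measureU2 _ _ _)) => //=.
have -> : (b - a)%:E = ((2^-1 * (b - a))%:E + (2^-1 * (- a - - b))%:E)%E.
  by rewrite -EFinD; congr EFin; lra.
by apply: leeD; apply: normal_prob_itv_le; lra.
Qed.

Lemma normal_prob_absball_ge (v : R) : 0 <= v ->
  ((4^-1 * Num.min v 1)%:E <= gauss [set x | (`|x| < v)%R])%E.
Proof.
move=> v0; set a := Num.min v 1.
have a0 : 0 <= a by rewrite le_min v0 ler01.
have a1 : a <= 1 by rewrite ge_min lexx orbT.
apply: (@le_trans _ _ (gauss `](- a)%R, a[)%E).
  apply: le_trans (normal_prob_itv_ge _); last by rewrite a0.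
  by rewrite lee_fin; lra.
apply: le_measure; rewrite ?inE//; first exact: measurable_absball.
move=> x /=; rewrite in_itv/= -ltr_norml => /lt_le_trans; apply.
by rewrite /a ge_min lexx.
Qed.

(* On |x| >= t the density is at most 2 exp (- t^2 / 4) times the density of a normal
   variable of variance 2. *)
Lemma normal_prob_absray_le (t : R) : 0 <= t ->
  (gauss [set x | (t <= `|x|)%R] <= (2 * expR (- t ^+ 2 / 4))%:E)%E.
Proof.
move=> t0; rewrite /normal_prob.
set s : R := Num.sqrt 2.
have s2 : s ^+ 2 = 2 by rewrite sqr_sqrtr.
have s0 : s != 0 by rewrite gt_eqF// sqrtr_gt0.
set K := 2 * expR (- t ^+ 2 / 4).
have K0 : 0 <= K by rewrite mulr_ge0// expR_ge0.
apply: (@le_trans _ _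
   (\int[mu]_(x in [set x | (t <= `|x|)%R]) (K%:E * (normal_pdf 0 s x)%:E))%E).
  apply: ge0_le_integral => //.
  - exact: measurable_absray.
  - exact: measurable_funeM.
  move=> x /= tx; rewrite -EFinM lee_fin.
  rewrite !normal_pdfE ?oner_eq0// /normal_peak /normal_fun expr1n mul1r !subr0 s2.
  have -> : (Num.sqrt (pi *+ 2 : R))^-1 = s * (Num.sqrt (2 * pi *+ 2 : R))^-1.
    rewrite -mulrnAr sqrtrM// invfM mulrA divff ?mul1r//.
  rewrite -mulrA mulrCA [leRHS]mulrCA -/s ler_wpM2l//.
  rewrite /K -[leRHS]mulrA.
  have s22 : s <= 2 by rewrite -(@ler_pXn2r _ 2) ?nnegrE ?sqrtr_ge0// s2; lra.
  apply: ler_pM; rewrite ?sqrtr_ge0 ?expR_ge0//.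
  (* One half of the exponent [- x^2 / 2] is the exponent for variance 2; the other half is at most
     [- t^2 / 4]. *)
  rewrite -expRD ler_expR.
  have : t ^+ 2 <= x ^+ 2 by rewrite -[x ^+ 2]real_normK ?num_real// ler_pXn2r ?nnegrE.
  lra.
apply: (@le_trans _ _ (\int[mu]_x (K%:E * (normal_pdf 0 s x)%:E))%E).
  apply: ge0_subset_integral => //.
  - exact: measurable_absray.
  - exact: measurable_funeM.
  by move=> x _; rewrite mule_ge0.
rewrite ge0_integralZl//.
have -> : (\int[mu]_x (normal_pdf 0 s x)%:E = 1)%E by exact: integral_normal_pdf.
by rewrite mule1.
Qed.

End StandardNormal.

(** * Matrices of independent half-normal entries *)

(** Pulling a factor [q] out of each [p i] leaves [q ^+ #|S| <= q ^+ K] times one term of the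
    expansion of the product of [r i + (1 - r i) = 1]. *)
Lemma sum_subset_prod_le (R : realType) (I : finType) (p r : I -> R) (q : R) (K : nat) :
  0 <= q <= 1 -> (forall i, 0 <= p i) -> (forall i, 0 <= r i <= 1) ->
  (forall i, p i <= q * r i) ->
  \sum_(S : {set I} | (K <= #|S|)%N) \prod_i (if i \in S then p i else 1 - r i)
    <= q ^+ K.
Proof.
move=> /andP[q0 q1] p0 r01 pr.
have F0 (S : {set I}) i : 0 <= (if i \in S then r i else 1 - r i).
  by case: ifP => _; have /andP[] := r01 i; rewrite ?subr_ge0.
apply: (@le_trans _ _ (\sum_(S : {set I})
    q ^+ K * \prod_i (if i \in S then r i else 1 - r i))).
  rewrite [leRHS](bigID (fun S : {set I} => (K <= #|S|)%N))/= -[leLHS]addr0.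
  apply: lerD; last by apply: sumr_ge0 => S _; rewrite mulr_ge0 ?exprn_ge0// prodr_ge0.
  apply: ler_sum => S KS.
  apply: (@le_trans _ _ (q ^+ #|S| * \prod_i (if i \in S then r i else 1 - r i))).
    rewrite -prodr_const [X in X * _]big_mkcond/= -big_split/=.
    apply: ler_prod => i _; case: ifP => iS; first by rewrite p0 pr.
    by rewrite mul1r lexx andbT; have := F0 S i; rewrite iS.
  by apply: ler_wpM2r; [exact: prodr_ge0|exact: ler_wiXn2l].
rewrite -big_distrr/= -(bigA_distr _ _ r (fun i => 1 - r i)).
by rewrite big1 ?mulr1// => i _ /=; rewrite addrC subrK.
Qed.

Lemma bigsetUP (T : Type) (I : finType) (Q : pred I) (A : I -> set T) (w : T) :
  (\big[setU/set0]_(i | Q i) A i) w <-> exists2 i, Q i & A i w.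
Proof.
split=> [|[i Qi Aw]]; last by rewrite (bigD1 i)//=; left.
elim/big_rec: _ => [//|i X Qi IH [Aw|/IH//]]; by exists i.
Qed.

Section Pr.
Context d (T : measurableType d) (R : realType) (P : probability T R).

Definition pr (A : set T) : R := fine (P A).

Lemma prE A : measurable A -> P A = (pr A)%:E.
Proof. by move=> mA; rewrite fineK// fin_num_measure. Qed.

Lemma pr_le A B : measurable A -> measurable B -> A `<=` B -> pr A <= pr B.
Proof.
by move=> mA mB AB; rewrite -lee_fin -!prE//; apply: le_measure; rewrite ?inE.
Qed.

Lemma pr_bigsetU (I : finType) (Q : pred I) (A : I -> set T) :
  (forall i, Q i -> measurable (A i)) ->
  pr (\big[setU/set0]_(i | Q i) A i) <= \sum_(i | Q i) pr (A i).
Proof.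
move=> mA.
suff [] : measurable (\big[setU/set0]_(i | Q i) A i) /\
  pr (\big[setU/set0]_(i | Q i) A i) <= \sum_(i | Q i) pr (A i) by [].
apply: (big_ind2 (fun X x => measurable X /\ pr X <= x)).
- by split=> //; rewrite /pr measure0.
- move=> X x Y y [mX Xx] [mY Yy]; split; first exact: measurableU.
  apply: le_trans (lerD Xx Yy).
  rewrite -lee_fin EFinD -!prE//; last exact: measurableU.
  exact: measureU2.
- by move=> i Qi; split=> //; exact: mA.
Qed.

Lemma bigsetU_measurable_fin (I : finType) (Q : pred I) (A : I -> set T) :
  (forall i, Q i -> measurable (A i)) ->
  measurable (\big[setU/set0]_(i | Q i) A i).
Proof. by move=> mA; elim/big_ind: _ => //; exact: measurableU. Qed.

End Pr.

Section HalfNormalMatrix.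
Context d (T : measurableType d) (R : realType) (P : probability T R).
Variables (m n : nat) (G : 'I_m * 'I_n -> {RV P >-> R}).
Hypothesis indG : mutually_independent P G.
Hypothesis normG : forall ij, distribution P (G ij) = normal_prob 0 1.

(** The half-normal law, which is the law of each entry of the random matrix. *)
Definition hprob (Y : set R) : R := fine (normal_prob (0 : R) 1 [set x | Y `|x|]).

Lemma hprob_ge0 Y : 0 <= hprob Y.
Proof. by rewrite /hprob fine_ge0. Qed.

Lemma measurable_abspre (Y : set R) : measurable Y -> measurable [set x : R | Y `|x|].
Proof.
move=> mY; rewrite -[X in measurable X]setTI.
exact: (@normr_measurable R setT measurableT).
Qed.

Lemma measurable_entry (Y : set R) i j : measurable Y ->
  measurable [set w | Y `|G (i, j) w|].
Proof.
move=> mY; rewrite -[X in measurable X]setTI.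
have mG : measurable_fun setT (G (i, j)) by exact: measurable_funPT.
exact: mG measurableT _ (measurable_abspre mY).
Qed.

Lemma pr_entry (Y : set R) i j : measurable Y ->
  pr P [set w | Y `|G (i, j) w|] = hprob Y.
Proof. by move=> mY; rewrite /pr /hprob -(normG (i, j)). Qed.

Lemma measurable_rect (X : 'I_m -> 'I_n -> set R) :
  (forall i j, measurable (X i j)) ->
  measurable [set w | forall i j, X i j `|G (i, j) w|].
Proof.
move=> mX.
have -> : [set w | forall i j, X i j `|G (i, j) w|] =
    ~` \big[setU/set0]_(ij : 'I_m * 'I_n) ~` [set w | X ij.1 ij.2 `|G (ij.1, ij.2) w|].
  apply/seteqP; split => w /=.
    by move=> h /bigsetUP[[i j] _] /=; apply.
  move=> h i j; apply: contrapT => hn; apply: h; apply/bigsetUP.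
  by exists (i, j).
apply: measurableC; apply: bigsetU_measurable_fin => -[i j] _.
by apply: measurableC; exact: measurable_entry.
Qed.

Lemma pr_rect (X : 'I_m -> 'I_n -> set R) :
  (forall i j, measurable (X i j)) ->
  pr P [set w | forall i j, X i j `|G (i, j) w|] = \prod_i \prod_j hprob (X i j).
Proof.
move=> mX.
have := @indG [set: 'I_m * 'I_n]%SET
  (fun ij => [set x : R | X ij.1 ij.2 `|x|]) (fun ij => measurable_abspre (mX _ _)).
have -> : \bigcap_(ij in [set ij | ij \in [set: 'I_m * 'I_n]%SET])
    (G ij @^-1` [set x : R | X ij.1 ij.2 `|x|]) =
    [set w | forall i j, X i j `|G (i, j) w|].
  apply/seteqP; split => w /= h.
    by move=> i j; apply: (h (i, j)); rewrite /= inE.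
  by move=> [i j] _ /=; exact: h.
rewrite (prE P (measurable_rect mX)).
rewrite (eq_bigr (fun ij => (hprob (X ij.1 ij.2))%:E)); last first.
  by move=> [i j] _ /=; rewrite -(pr_entry i j (mX i j)) -prE//; exact: measurable_entry.
rewrite prodEFin => -[->].
rewrite pair_big/=; apply: eq_bigl => -[i j]; by rewrite inE.
Qed.

(** Each row is certified by one of finitely many boxes. A union bound over all choices of
    certificates, independence inside each choice, and distributivity turn the sum over choices into
    a product over rows. *)
Lemma pr_row_cover (Z : finType) (X : 'I_m -> Z -> 'I_n -> set R) (A : set T) :
  (forall i z j, measurable (X i z j)) -> measurable A ->
  A `<=` [set w | forall i, exists z, forall j, X i z j `|G (i, j) w|] ->
  pr P A <= \prod_i \sum_z \prod_j hprob (X i z j).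
Proof.
move=> mX mA sub.
rewrite bigA_distr_bigA/=.
pose B (f : {ffun 'I_m -> Z}) := [set w | forall i j, X i (f i) j `|G (i, j) w|].
have mB f : measurable (B f) by exact: (@measurable_rect (fun i j => X i (f i) j)).
apply: (@le_trans _ _ (pr P (\big[setU/set0]_(f : {ffun 'I_m -> Z}) B f))).
  apply: pr_le => //; first exact: bigsetU_measurable_fin.
  move=> w /sub /= /choice[f hf]; apply/bigsetUP; exists (finfun f) => //.
  by move=> i j; rewrite /= ffunE.
apply: (le_trans (pr_bigsetU P (fun f _ => mB f))).
by apply: ler_sum => f _; rewrite (@pr_rect (fun i j => X i (f i) j)).
Qed.

End HalfNormalMatrix.

Lemma measurable_ltray (R : realType) (v : R) : measurable [set x : R | x < v].
Proof.
have -> : [set x : R | x < v] = [set` `]-oo, v[] by apply/seteqP; split => x /=; rewrite in_itv.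
exact: measurable_itv.
Qed.

Lemma measurable_geray (R : realType) (v : R) : measurable [set x : R | v <= x].
Proof.
have -> : [set x : R | v <= x] = [set` `[v, +oo[] by apply/seteqP; split => x /=; rewrite in_itv/= andbT.
exact: measurable_itv.
Qed.

Lemma measurable_cohalf (R : realType) (a b : R) : measurable [set x : R | a <= x < b].
Proof.
have -> : [set x : R | a <= x < b] = [set` `[a, b[] by apply/seteqP; split => x /=; rewrite in_itv.
exact: measurable_itv.
Qed.

(** * Joint probability of light rows and rows with a large entry *)

Section Rows.
Context d (T : measurableType d) (R : realType) (P : probability T R).
Variables (m n : nat) (G : 'I_m * 'I_n -> {RV P >-> R}).
Hypothesis n_gt0 : (0 < n)%N.
Hypothesis indG : mutually_independent P G.
Hypothesis normG : forall ij, distribution P (G ij) = normal_prob 0 1.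

Definition big_row (v : R) i : set T := [set w | exists j, v <= `|G (i, j) w|].

Definition light_row (a : R) i : set T := [set w | \sum_j `|G (i, j) w| < n%:R * a].

Lemma measurable_big_row v i : measurable (big_row v i).
Proof.
have -> : big_row v i = \big[setU/set0]_(j : 'I_n) [set w | v <= `|G (i, j) w|].
  by apply/seteqP; split => w /=; rewrite bigsetUP => -[j]; exists j.
apply: bigsetU_measurable_fin => j _.
apply: (@measurable_entry _ _ _ _ _ _ G [set x | v <= x]).
exact: measurable_geray.
Qed.

Lemma measurable_light_row a i : measurable (light_row a i).
Proof.
have mf : measurable_fun setT (fun w => \sum_j `|G (i, j) w|).
  apply: measurable_sum => j; apply: measurableT_comp; first exact: normr_measurable.
  exact: measurable_funPT.
have -> : light_row a i = setT `&` (fun w => \sum_j `|G (i, j) w|) @^-1` `]-oo, n%:R * a[.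
  by rewrite setTI; apply/seteqP; split => w /=; rewrite in_itv.
exact: mf.
Qed.

Definition pattern (v a : 'I_m -> R) (S : {set 'I_m}) : set T :=
  [set w | forall i, if i \in S then light_row (a i) i w else big_row (v i) i w].

Lemma measurable_pattern v a S : measurable (pattern v a S).
Proof.
have -> : pattern v a S =
    ~` \big[setU/set0]_i ~` (if i \in S then light_row (a i) i else big_row (v i) i).
  apply/seteqP; split => w /=.
    by move=> h /bigsetUP[i _] /=; apply; have := h i; case: ifP.
  move=> h i; apply: contrapT => hn; apply: h; apply/bigsetUP.
  by exists i => //= h; apply: hn; move: h; case: ifP.
apply: measurableC; apply: bigsetU_measurable_fin => i _.
by apply: measurableC; case: ifP => _; [exact: measurable_light_row|exact: measurable_big_row].
Qed.

Definition hball (v : R) : R := hprob [set x : R | x < v].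

Lemma hprobT : hprob [set: R] = 1.
Proof. by rewrite /hprob (_ : [set x | _] = setT) ?probability_setT. Qed.

Lemma hprob0 : hprob (set0 : set R) = 0.
Proof. by rewrite /hprob (_ : [set x | _] = set0) ?measure0. Qed.

Lemma hball_ge0 v : 0 <= hball v.
Proof. exact: hprob_ge0. Qed.

Lemma hprob_geray (v : R) : hprob [set x : R | v <= x] = 1 - hball v.
Proof.
rewrite /hball /hprob.
have -> : [set x : R | [set x | v <= x] `|x|] = ~` [set x : R | [set x | x < v] `|x|].
  apply/seteqP; split => x /=; first by rewrite leNgt => /negP.
  by move/negP; rewrite -leNgt.
rewrite probability_setC; last exact: (measurable_abspre (measurable_ltray v)).
rewrite fineB ?fin_num_measure//.
exact: (measurable_abspre (measurable_ltray v)).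
Qed.

Lemma hball_le1 v : hball v <= 1.
Proof. by rewrite -subr_ge0 -hprob_geray hprob_ge0. Qed.

Lemma sum_first_exceed (b : R) :
  \sum_(j0 < n) b ^+ j0 * (1 - b) = 1 - b ^+ n.
Proof. by rewrite -mulr_suml mulrC -[RHS]opprB subrX1 -mulNr opprB. Qed.

Lemma hprob_cohalf_le (a : R) (k : nat) : 0 <= a ->
  hprob [set x | a * k%:R <= x < a * k.+1%:R] <= a.
Proof.
move=> a0; rewrite -lee_fin /hprob fineK; last first.
  by rewrite fin_num_measure//; exact: measurable_absitv.
apply: (le_trans (@normal_prob_absitv_le R (a * k%:R) (a * k.+1%:R) _)).
  by rewrite mulr_ge0// ler_wpM2l// ler_nat leqnSn.
by rewrite lee_fin -mulrBr -natrB// subSnn mulr1.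
Qed.

Lemma sum_half_pow (k : nat) : \sum_(i < k) (2^-1 : R) ^+ i <= 2.
Proof.
have := subrX1 (2^-1 : R) k.
have : 0 <= (2^-1 : R) ^+ k by rewrite exprn_ge0// invr_ge0.
move: (_ ^+ k) (\sum_(_ < _) _) => x y x0 h; lra.
Qed.

(* [t j] is the integer part of |G_ij| / a; the union bound over the vectors [t]
   with sum at most n is done with the weights 2 ^ (n - sum t) >= 1. *)
Lemma sum_hprob_cells_le (a : R) : 0 <= a ->
  \sum_(t : {ffun 'I_n -> 'I_n.+1}) \prod_j
    hprob (if (\sum_j t j <= n)%N then [set x | a * (t j)%:R <= x < a * (t j).+1%:R]
           else set0)
  <= (4 * a) ^+ n.
Proof.
move=> a0.
have w0 (k : nat) : 0 <= 2 * (2^-1 : R) ^+ k.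
  by rewrite mulr_ge0// exprn_ge0// invr_ge0.
apply: (@le_trans _ _ (\sum_(t : {ffun 'I_n -> 'I_n.+1}) \prod_j
    (a * (2 * 2^-1 ^+ (t j))))).
  apply: ler_sum => t _; case: (boolP (\sum_j t j <= n)%N) => tn; last first.
    by apply: ler_prod => j _; rewrite hprob_ge0/= hprob0 mulr_ge0.
  apply: (@le_trans _ _ (\prod_(j < n) a)).
    by apply: ler_prod => j _; rewrite hprob_ge0/= hprob_cohalf_le.
  rewrite big_split/= -[leLHS]mulr1 ler_wpM2l ?prodr_ge0//.
  rewrite big_split/= prodr_const card_ord (prodrXr _ _ _ (fun j => t j : nat)) exprVn.
  rewrite -[leLHS](@divff _ (2 ^+ (\sum_j t j)%N)) ?expf_neq0//.
  by rewrite ler_wpM2r ?invr_ge0 ?exprn_ge0// ler_weXn2l// ler1n.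
(* The majorant factorizes over columns; each factor is [2 * a] times a geometric sum of at most
   2. *)
rewrite -(bigA_distr_bigA (fun (j : 'I_n) (k : 'I_n.+1) => a * (2 * 2^-1 ^+ k)))/=.
rewrite -[X in _ <= _ ^+ X](card_ord n) -prodr_const.
apply: ler_prod => j _; rewrite sumr_ge0/=; last by move=> k _; rewrite mulr_ge0.
by rewrite -mulr_sumr -mulr_sumr mulrC ler_wpM2r//; have := sum_half_pow n.+1; lra.
Qed.

(** Splitting by the first column reaching [v] writes the event as disjoint boxes. The value is
    therefore exact, as the expansion of [r + (1 - r)] requires; a union over columns would only
    give [n * (1 - hball v)]. *)
Lemma sum_hprob_first_exceed (v : R) :
  \sum_(j0 < n) \prod_(j < n)
     hprob (if (j < j0)%N then [set x | x < v]
            else if j == j0 then [set x | v <= x] else setT)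
  = 1 - hball v ^+ n.
Proof.
rewrite -sum_first_exceed; apply: eq_bigr => j0 _.
rewrite (bigID (fun j : 'I_n => (j < j0)%N))/=; congr (_ * _).
  rewrite (eq_bigr (fun=> hball v)); last by move=> j ->.
  by rewrite -(@big_ord_widen _ _ _ j0 n (fun=> hball v) (ltnW (ltn_ord j0))) prodr_const card_ord.
rewrite (bigD1 j0) ?ltnn//= eqxx hprob_geray big1 ?mulr1// => j /andP[/negbTE -> /negbTE ->].
exact: hprobT.
Qed.

Lemma pr_pattern_le (v a : 'I_m -> R) (S : {set 'I_m}) : (forall i, 0 <= a i) ->
  pr P (pattern v a S) <=
  \prod_i (if i \in S then (4 * a i) ^+ n else 1 - hball (v i) ^+ n).
Proof.
move=> a0.
(* Certificates: integer parts [t] for a light row, the first large column [j0] for any other row. A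
   certificate of the wrong kind gets empty boxes and adds nothing to the sum. *)
pose X i (z : {ffun 'I_n -> 'I_n.+1} + 'I_n) (j : 'I_n) : set R :=
  match z with
  | inl t => if i \in S then
      (if (\sum_j t j <= n)%N then [set x | a i * (t j)%:R <= x < a i * (t j).+1%:R]
       else set0) else set0
  | inr j0 => if i \in S then set0 else
      (if (j < j0)%N then [set x | x < v i]
       else if j == j0 then [set x | v i <= x] else setT)
  end.
have mX i z j : measurable (X i z j).
  by case: z => [t|j0] /=; repeat case: ifP => _ //;
    [exact: measurable_cohalf|exact: measurable_ltray|exact: measurable_geray].
apply: (@le_trans _ _ (\prod_i \sum_z \prod_j hprob (X i z j))).
  apply: (pr_row_cover indG normG mX); first exact: measurable_pattern.
  move=> w /= h i; have := h i; rewrite /X; case: ifP => iS.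
    rewrite /light_row /= => lt.
    have S0 : 0 <= \sum_j `|G (i, j) w| by apply: sumr_ge0.
    have n0 : 0 < n%:R :> R by rewrite ltr0n.
    (* A sum of absolute values lies strictly below [n * a i], so the division by [a i] is
       legitimate. *)
    have ai : 0 < a i.
      by have := le_lt_trans S0 lt; rewrite pmulr_rgt0.
    pose t j := Num.truncn (`|G (i, j) w| / a i).
    have tj j : a i * (t j)%:R <= `|G (i, j) w| < a i * (t j).+1%:R.
      have /truncn_itv/andP[h1 h2] : 0 <= `|G (i, j) w| / a i by rewrite divr_ge0// ltW.
      by rewrite mulrC -ler_pdivlMr// h1 mulrC -ltr_pdivrMr.
    (* Rounding down gives [a i * \sum_j t j <= \sum_j |G_ij| < n * a i]; hence also every [t j]
       fits into ['I_n.+1]. *)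
    have tS : (\sum_j t j < n)%N.
      rewrite -(ltr_nat R) -(ltr_pM2r ai) natr_sum mulr_suml; apply: le_lt_trans lt.
      by apply: ler_sum => j _; have /andP[] := tj j; rewrite mulrC.
    have tn j : (t j < n.+1)%N.
      by apply: (@leq_ltn_trans (\sum_j t j)%N); [rewrite (bigD1 j)//= leq_addr|exact: ltnW].
    exists (inl [ffun j => Ordinal (tn j)]) => j.
    rewrite (eq_bigr t) ?(ltnW tS)//; last by move=> j' _; rewrite ffunE.
    by rewrite ffunE /= tj.
  move=> [j1 j1v].
  have [j0 j0v j0min] := @arg_minnP _ j1 (fun j => v i <= `|G (i, j) w|) (fun j => j : nat) j1v.
  exists (inr j0) => j /=; case: ltnP => jj0.
    rewrite /= ltNge; apply/negP => /j0min; by rewrite leqNgt jj0.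
  by case: eqP => [->|].
apply: ler_prod => i _; apply/andP; split.
  by apply: sumr_ge0 => z _; apply: prodr_ge0 => j _; exact: hprob_ge0.
(* Here [n > 0] matters: an empty product would be 1. *)
have prod0 : \prod_(j < n) hprob (set0 : set R) = 0.
  by rewrite hprob0 prodr_const card_ord expr0n; case: (n) n_gt0.
rewrite big_sumType/= /X; case: ifP => iS.
  by rewrite [X in _ + X]big1 ?addr0 ?sum_hprob_cells_le.
by rewrite [X in X + _]big1 ?add0r ?sum_hprob_first_exceed.
Qed.

Lemma pr_patterns_le (v a : 'I_m -> R) (q : R) (K : nat) :
  0 <= q <= 1 -> (forall i, 0 <= a i) ->
  (forall i, (4 * a i) ^+ n <= q * hball (v i) ^+ n) ->
  pr P (\big[setU/set0]_(S : {set 'I_m} | (K <= #|S|)%N) pattern v a S) <= q ^+ K.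
Proof.
move=> q01 a0 h.
apply: (le_trans (pr_bigsetU P (fun S _ => measurable_pattern v a S))).
apply: (@le_trans _ _ (\sum_(S : {set 'I_m} | (K <= #|S|)%N)
   \prod_i (if i \in S then (4 * a i) ^+ n else 1 - hball (v i) ^+ n))).
  by apply: ler_sum => S _; exact: pr_pattern_le.
apply: sum_subset_prod_le => // i; first by rewrite exprn_ge0// mulr_ge0.
by rewrite exprn_ge0 ?hball_ge0//= exprn_ile1 ?hball_ge0 ?hball_le1.
Qed.

Lemma pr_light_row_le (a : R) i : 0 <= a -> pr P (light_row a i) <= (4 * a) ^+ n.
Proof.
move=> a0.
(* With threshold 0 the condition on all other rows holds trivially, so the pattern bound
   specializes to one row. *)
apply: (@le_trans _ _ (pr P (pattern (fun=> 0) (fun=> a) [set i]%SET))).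
  apply: pr_le; [exact: measurable_light_row|exact: measurable_pattern|].
  move=> w wi k; rewrite inE; case: eqP => [->//|_].
  by exists (Ordinal n_gt0) => /=.
apply: (le_trans (@pr_pattern_le (fun=> 0) (fun=> a) _ (fun=> a0))).
rewrite (bigD1 i)//= inE eqxx -[leRHS]mulr1.
rewrite ler_wpM2l ?exprn_ge0 ?mulr_ge0//.
apply: prodr_ile1 => k ki; rewrite inE (negbTE ki) gerBl exprn_ge0 ?hball_ge0// andbT.
by rewrite subr_ge0 exprn_ile1 ?hball_ge0 ?hball_le1.
Qed.

End Rows.

(** * Cells of a hyperplane arrangement *)

Section Cells.
Variables (F : realFieldType) (N d : nat) (a : 'M[F]_(N, d)) (b : 'I_N -> F).

Definition afun (x : 'cV[F]_d) (p : 'I_N) : F := (a *m x) p 0 - b p.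

(** Not symmetric: [y] inherits the weak signs of [x], so it lies in the closure of the cell of
    [x]. *)
Definition same_cell (x y : 'cV[F]_d) : Prop :=
  forall p, (0 <= afun x p -> 0 <= afun y p) /\ (afun x p <= 0 -> afun y p <= 0).

Lemma same_cell_trans x y z : same_cell x y -> same_cell y z -> same_cell x z.
Proof.
move=> xy yz p; have [h1 h2] := xy p; have [h3 h4] := yz p.
by split=> [/h1/h3|/h2/h4].
Qed.

(** Rows that are not tight are zeroed rather than removed, which keeps the shape and leaves the row
    space spanned by the tight rows. *)
Definition tightmx (x : 'cV[F]_d) : 'M[F]_(N, d) :=
  \matrix_(p, j) (if afun x p == 0 then a p j else 0).

Lemma afunD x t v p : afun (x + t *: v) p = afun x p + t * (a *m v) p 0.
Proof. by rewrite /afun mulmxDr -scalemxAr !mxE; ring. Qed.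

Lemma tightmx_row x p (v : 'cV[F]_d) : afun x p = 0 -> (tightmx x *m v) p 0 = (a *m v) p 0.
Proof. by move=> xp; rewrite !mxE; apply: eq_bigr => j _; rewrite !mxE xp eqxx. Qed.

(* Moving along a direction orthogonal to the tight constraints until the first
   non-tight constraint becomes tight. *)
Lemma tighten x : ~~ (a <= tightmx x)%MS ->
  exists2 y, same_cell x y & (\rank (tightmx x) < \rank (tightmx y))%N.
Proof.
rewrite submxE => /eqP nz.
have [[p0 j0] /= pj] : exists pj : 'I_N * 'I_d, (a *m cokermx (tightmx x)) pj.1 pj.2 != 0.
  apply/existsP; apply: contraPT nz; rewrite negb_exists => /forallP h; apply.
  by apply/matrixP => p j; have /= := h (p, j); rewrite negbK [RHS]mxE => /eqP.
(* A direction orthogonal to all tight rows, but not to row [p0]. *)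
pose v := col j0 (cokermx (tightmx x)).
have av p : (a *m v) p 0 = (a *m cokermx (tightmx x)) p j0.
  by rewrite !mxE; apply: eq_bigr => l _; rewrite mxE.
have tv : tightmx x *m v = 0 by rewrite /v colE mulmxA mulmx_coker mul0mx.
have av0 p : afun x p = 0 -> (a *m v) p 0 = 0.
  by move=> xp; rewrite -(tightmx_row _ xp) tv mxE.
have Pp0 : (a *m v) p0 0 != 0 by rewrite av.
pose step p := - afun x p / (a *m v) p 0.
pose Q : pred 'I_N := fun p => (a *m v) p 0 != 0.
case: (@arg_minP _ F _ p0 Q (fun p => `|step p|) Pp0) => p1 /= Pp1 p1min.
pose y := x + step p1 *: v.
have yp1 : afun y p1 = 0 by rewrite afunD /step divfK// subrr.
have yt p : afun x p = 0 -> afun y p = 0 by move=> xp; rewrite afunD av0// xp mulr0 addr0.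
have cell : same_cell x y.
  move=> p; have [vp|vp] := eqVneq ((a *m v) p 0) 0.
    by rewrite afunD vp mulr0 addr0.
  (* By minimality of [|step p1|] no affine function moves past zero. *)
  have h : `|step p1 * (a *m v) p 0| <= `|afun x p|.
    have := p1min p vp; rewrite /step [in leRHS]normrM normrN [in leRHS]normfV.
    by rewrite ler_pdivlMr ?normr_gt0// -normrM.
  rewrite afunD; split=> hx; move: h.
    by rewrite (ger0_norm hx) ler_norml => /andP[h1 h2]; lra.
  by rewrite (ler0_norm hx) ler_norml => /andP[h1 h2]; lra.
exists y => //.
apply: rank_ltmx; rewrite /ltmx; apply/andP; split.
  have -> : tightmx x = diag_mx (\row_p (if afun x p == 0 then 1 else 0)) *m tightmx y.
    apply/matrixP => p j; rewrite mul_diag_mx !mxE.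
    by case: eqP => [/yt ->|_]; rewrite ?eqxx ?mul1r ?mul0r.
  exact: submxMl.
(* The rank grows strictly: [v] annihilates the tight rows of [x] but not the newly tight row
   [p1]. *)
apply: contraNN Pp1 => /submxP[D yD]; rewrite -(tightmx_row _ yp1) yD -mulmxA tv.
by rewrite mulmx0 mxE.
Qed.

(** Iterating [tighten] terminates because the rank is at most [d]. *)
Lemma tight_point x : exists2 y, same_cell x y & (a <= tightmx y)%MS.
Proof.
have [k] := ubnP (d - \rank (tightmx x)); elim: k x => // k IH x hk.
have [|/tighten[y xy ry]] := boolP (a <= tightmx x)%MS; first by exists x.
have [|z yz za] := IH y.
  have := rank_leq_col (tightmx y); lia.
by exists z => //; exact: same_cell_trans xy yz.
Qed.

(** At a point whose tight rows span all rows, a basis of at most [d] tight constraints determines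
    every affine function. Naming such a basis by [d] optional indices bounds the number of
    representatives by [(N + 1) ^ d]. *)
Lemma cell_representatives :
  exists rep : {ffun 'I_d -> option 'I_N} -> 'cV[F]_d,
  forall x, exists J, same_cell x (rep J).
Proof.
pose spans (J : {ffun 'I_d -> option 'I_N}) :=
  forall y z, (forall k p, J k = Some p -> afun y p = 0) ->
    (forall k p, J k = Some p -> afun z p = 0) -> forall p, afun y p = afun z p.
have main x : exists J y, [/\ same_cell x y, spans J & forall k p, J k = Some p -> afun y p = 0].
  have [y xy ay] := tight_point x.
  pose M := tightmx y; pose f := maxrankfun M.
  (* Entries beyond the rank are padded with [None]. *)
  pose J : {ffun 'I_d -> option 'I_N} := [ffun k : 'I_d =>
     if (insub (val k) : option 'I_(\rank M)) is Some k' then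
     (if afun y (f k') == 0 then Some (f k') else None) else None].
  have yJ k p : J k = Some p -> afun y p = 0.
    by rewrite ffunE; case: insubP => // k' _ _; case: eqP => // h [<-].
  exists J, y; split=> //.
  suff key z : (forall k p, J k = Some p -> afun z p = 0) -> forall p, afun z p = afun y p.
    by move=> u z hu hz p; rewrite (key u hu) (key z hz).
  move=> hz p.
  have /submxP[D aD] : (a <= rowsub f M)%MS by rewrite eq_maxrowsub.
  have zero : rowsub f M *m (z - y) = 0.
    apply/matrixP => k j; rewrite [j]ord1 [RHS]mxE.
    have -> : (rowsub f M *m (z - y)) k 0 = (M *m (z - y)) (f k) 0.
      by rewrite !mxE; apply: eq_bigr => l _; rewrite !mxE.
    have [yf|yf] := eqVneq (afun y (f k)) 0; last first.
      by rewrite mxE big1// => l _; rewrite !mxE (negbTE yf) mul0r.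
    rewrite tightmx_row// mulmxBr !mxE.
    have kd : (k < d)%N by apply: leq_trans (ltn_ord k) (rank_leq_col _).
    have /hz : J (Ordinal kd) = Some (f k).
      rewrite ffunE /=; case: insubP => [k' _ /val_inj ->|]; last by rewrite ltn_ord.
      by rewrite yf eqxx.
    move: yf; rewrite /afun !mxE => h1 h2; lra.
  rewrite /afun; congr (_ - _).
  have : a *m (z - y) = 0 by rewrite aD -mulmxA zero mulmx0.
  rewrite mulmxBr => /eqP; rewrite subr_eq0 => /eqP->//.
pose zero (J : {ffun 'I_d -> option 'I_N}) (y : 'cV[F]_d) :=
  forall k p, J k = Some p -> afun y p = 0.
(* Any solution of the equations named by [J] will do, since by [spans] all solutions give the same
   values. Inconsistent codes get the default 0. *)
have /choice[rep repP] : forall J, exists z, forall y, zero J y -> zero J z.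
  move=> J; have [[z hz]|hz] := pselect (exists z, zero J z); first by exists z.
  by exists 0 => y hy; exfalso; apply: hz; exists y.
exists rep => x; have [J [y [xy sJ yJ]]] := main x.
exists J; apply: same_cell_trans xy _ => p.
by rewrite (sJ y (rep J))//; exact: repP yJ.
Qed.

End Cells.

(** * Uniform control of the light rows *)

(** With [v_i = (u_i - (A x)_i) / s], the premise is [v_i / 2 <= M_i]; the factor 2 is slack that
    makes the premise easy to derive from feasibility. The conclusion counts the light rows. *)
Definition few_light_rows (R : realType) (m n : nat) (u : 'I_m -> R)
    (A B : 'M[R]_(m, n)) (kap K : R) : Prop :=
  forall (x : 'cV[R]_n) (s : R), 0 < s ->
    (forall i, exists j, (u i - (A *m x) i 0) / (2 * s) <= B i j) ->
    (#|[set i | kap / n%:R * (\sum_j B i j) < (u i - (A *m x) i 0) / s]%SET|)%:R <= K.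

Lemma dyadic_level (R : realType) (tau v : R) (k : nat) :
  tau < v -> v <= 2 ^+ k * tau ->
  exists2 l, (l < k)%N & 2 ^+ l * tau <= v <= 2 ^+ l.+1 * tau.
Proof.
move=> tv vk.
have ex : exists l, v <= 2 ^+ l * tau by exists k.
case: (ex_minnP ex) => -[|l] vl lmin; first by move: vl; rewrite mul1r leNgt tv.
exists l; first exact: lmin.
rewrite vl andbT leNgt; apply/negP => /ltW /lmin; by rewrite ltnn.
Qed.

Section LightRows.
Context d (T : measurableType d) (R : realType) (P : probability T R).
Variables (m n : nat) (G : 'I_m * 'I_n -> {RV P >-> R}).
Hypothesis n_gt0 : (0 < n)%N.
Hypothesis indG : mutually_independent P G.
Hypothesis normG : forall ij, distribution P (G ij) = normal_prob 0 1.
Variables (u : 'I_m -> R) (A : 'M[R]_(m, n)) (kap tau V : R) (k K : nat).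
Hypotheses (kap0 : 0 < kap) (tau0 : 0 < tau).
Hypothesis V_le : 2 * V <= 2 ^+ k * tau.

Let lvl := ('I_m * 'I_k.+1)%type.
(** Homogenization: at the vector [(1 / s, x / s)] row [i] takes the value [(u_i - (A x)_i) / s], so
    all demands are linear in [n + 1] parameters. [cellmx] repeats each row once per dyadic
    level. *)
Let W : 'M[R]_(m, 1 + n) := row_mx (\col_i u i) (- A).
Let cellmx : 'M[R]_(#|{: lvl}|, 1 + n) := rowsub (fun p => (enum_val p : lvl).1) W.
Let cellcst (p : 'I_#|{: lvl}|) : R := 2 ^+ (enum_val p : lvl).2 * tau.
Let code := {ffun 'I_(1 + n) -> option 'I_#|{: lvl}|}.

Lemma card_code : #|{: code}| = ((m * k.+1).+1 ^ n.+1)%N.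
Proof. by rewrite card_ffun card_option !card_ord card_prod !card_ord. Qed.

(* With v the value at the representative point, v / 4 is at most half of the value at any
   point z of the cell, and at least an eighth of it when that is at least 2 tau. *)
Let thr (rep : code -> 'cV[R]_(1 + n)) (J : code) (i : 'I_m) : R :=
  let v := (W *m rep J) i 0 in if tau < v then v / 4 else 0.

Lemma thr_ge0 rep J i : 0 <= thr rep J i.
Proof. by rewrite /thr; case: ifP => // h; have := lt_trans tau0 h; lra. Qed.

Lemma afun_cell (z : 'cV[R]_(1 + n)) (i : 'I_m) (l : 'I_k.+1) :
  afun cellmx cellcst z (enum_rank (i, l)) = (W *m z) i 0 - 2 ^+ l * tau.
Proof.
rewrite /afun /cellcst enum_rankK /=; congr (_ - _).
by rewrite !mxE; apply: eq_bigr => j _; rewrite !mxE enum_rankK.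
Qed.

(** The three bad events. [heavy] bounds the range of demands from above, [starved] makes demands
    below the lowest dyadic levels irrelevant, and [crowded] is the union bound over cells. *)
Let heavy : set T := \big[setU/set0]_(ij : 'I_m * 'I_n) [set w | V <= `|G (ij.1, ij.2) w|].
Let starved : set T := \big[setU/set0]_(i : 'I_m) light_row G (2 * tau / kap) i.
Let crowded rep : set T :=
  \big[setU/set0]_(J : code | [forall i, thr rep J i <= V])
  \big[setU/set0]_(S : {set 'I_m} | (K < #|S|)%N)
     pattern G (thr rep J) (fun i => 8 * thr rep J i / kap) S.

(** A violating [(x, s)] lies in some cell, and its demands agree with those of the representative
    up to a factor 2. Its light rows then form a pattern for the representative with more than [K]
    rows, so [crowded] occurs. *)
Lemma few_light_rowsP rep w :
  (forall x, exists J, same_cell cellmx cellcst x (rep J)) ->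
  ~ heavy w -> ~ starved w -> ~ crowded rep w ->
  few_light_rows u A (absmx G w) kap K%:R.
Proof.
move=> repP nheavy nstarved ncrowded x s s0 big.
have n0 : 0 < n%:R :> R by rewrite ltr0n.
pose z : 'cV[R]_(1 + n) := col_mx (s^-1)%:M (s^-1 *: x).
have [J zJ] := repP z.
have zE i : (W *m z) i 0 = (u i - (A *m x) i 0) / s.
  rewrite mul_row_col mul_mx_scalar mulNmx -scalemxAr !mxE; ring.
have BV i j : absmx G w i j < V.
  rewrite mxE ltNge; apply/negP => h; apply: nheavy; apply/bigsetUP.
  by exists (i, j).
have bigz i : exists j, (W *m z) i 0 / 2 <= absmx G w i j.
  have [j hj] := big i; exists j; apply: le_trans hj.
  by rewrite zE invfM le_eqVlt; apply/orP; left; apply/eqP; ring.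
have zV i : (W *m z) i 0 <= 2 ^+ k * tau.
  have [j hj] := bigz i; have := BV i j; have := V_le; lra.
have upper i (l : nat) : (l <= k)%N -> (W *m z) i 0 <= 2 ^+ l * tau ->
    (W *m rep J) i 0 <= 2 ^+ l * tau.
  move=> lk h; have [_] := zJ (enum_rank (i, Ordinal (lk : (l < k.+1)%N))).
  by rewrite !afun_cell /= !subr_le0; apply.
have lower i (l : nat) : (l <= k)%N -> 2 ^+ l * tau <= (W *m z) i 0 ->
    2 ^+ l * tau <= (W *m rep J) i 0.
  move=> lk h; have [+ _] := zJ (enum_rank (i, Ordinal (lk : (l < k.+1)%N))).
  by rewrite !afun_cell /= !subr_ge0; apply.
(* If [v] at [z] has level [l], the representative is at most [2 ^+ l.+1 * tau <= 2 * v], so a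
   quarter of it is at most [v / 2]. *)
have thr_le i : exists2 j, thr rep J i <= absmx G w i j & thr rep J i <= V.
  have [j hj] := bigz i; have Bj := BV i j.
  suff h : thr rep J i <= absmx G w i j by exists j => //; apply: ltW; exact: le_lt_trans Bj.
  rewrite /thr; case: ifPn => [tv|_]; last by rewrite mxE.
  have tz : tau < (W *m z) i 0.
    rewrite ltNge; apply: contraTN tv => zt.
    by rewrite -leNgt; have := @upper i 0 (leq0n _); rewrite mul1r; apply.
  have [l lk /andP[l1 l2]] := dyadic_level tz (zV i).
  have := @upper i l.+1 lk l2; rewrite exprS -mulrA; lra.
set S := [set i | _]%SET.
rewrite ler_nat leqNgt; apply/negP => KS; apply: ncrowded; apply/bigsetUP.
exists J; first by apply/forallP => i; have [] := thr_le i.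
apply/bigsetUP; exists S => //.
move=> i; rewrite /S inE; case: ifPn => [iS|_]; last first.
  by have [j + _] := thr_le i; rewrite mxE => hj; exists j.
have sumE : \sum_j `|G (i, j) w| = \sum_j absmx G w i j by apply: eq_bigr => j _; rewrite mxE.
(* Outside [starved], a light row must have demand above [2 * tau], so its representative stays
   above the cutoff [tau]. *)
have St : n%:R * (2 * tau / kap) <= \sum_j absmx G w i j.
  rewrite leNgt -sumE; apply/negP => h; apply: nstarved; apply/bigsetUP.
  by exists i.
rewrite /light_row /= sumE.
move: iS St; rewrite -zE; set X := \sum_j _ => iS St.
have kn0 : 0 < kap / n%:R by rewrite divr_gt0.
have fE (r : R) : kap / n%:R * (n%:R * (r / kap)) = r.
  by field; rewrite !gt_eqF.
have St' : 2 * tau <= kap / n%:R * X.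
  by rewrite -(fE (2 * tau)) ler_pM2l.
have v2 := le_lt_trans St' iS.
have tz : tau < (W *m z) i 0 by have := tau0; lra.
have [l lk /andP[l1 l2]] := dyadic_level tz (zV i).
have lw := @lower i l (ltnW lk) l1.
have tv : tau < (W *m rep J) i 0.
  move: l2; rewrite exprS -mulrA; lra.
have v8 : (W *m z) i 0 <= 8 * thr rep J i.
  rewrite /thr tv; move: l2; rewrite exprS -mulrA; lra.
rewrite -(ltr_pM2l kn0) fE; exact: lt_le_trans v8.
Qed.

Lemma hball_ge (v : R) : 0 <= v -> 4^-1 * Num.min v 1 <= hball v.
Proof.
move=> v0; have := normal_prob_absball_ge v0; rewrite -lee_fin /hball /hprob fineK//.
by rewrite fin_num_measure//; exact: measurable_absball.
Qed.

Lemma hprob_tail (t : R) : 0 <= t -> hprob [set x | t <= x] <= 2 * expR (- t ^+ 2 / 4).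
Proof.
move=> t0; have := normal_prob_absray_le t0; rewrite -lee_fin /hprob fineK//.
by rewrite fin_num_measure//; exact: measurable_absray.
Qed.

(** Since [v <= V * min v 1] and [hball v >= min v 1 / 4], the constant is [4 * 8 * 4 = 128], with
    [expR 1] for the gain per entry. *)
Lemma light_ratio (v : R) : 1 <= V -> 128 * V * expR 1 <= kap -> 0 <= v <= V ->
  (4 * (8 * v / kap)) ^+ n <= expR (- 1) ^+ n * hball v ^+ n.
Proof.
move=> V1 hk /andP[v0 vV]; rewrite -exprMn_comm; last exact: mulrC.
apply: lerXn2r; rewrite ?nnegrE ?mulr_ge0 ?expR_ge0 ?hball_ge0 ?invr_ge0 ?(ltW kap0)//.
apply: le_trans (ler_wpM2l (expR_ge0 _) (hball_ge v0)).
have vm : v <= V * Num.min v 1.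
  case: (leP v 1) => _; last by rewrite mulr1.
  by rewrite ler_peMl.
have m0 : 0 <= Num.min v 1 by rewrite le_min v0 ler01.
rewrite expRN; have e0 := expR_gt0 (1 : R).
move: (expR 1) (Num.min v 1) e0 hk vm m0 => e w e0 hk vm m0.
have -> : 4 * (8 * v / kap) = (32 * v) / kap by ring.
rewrite ler_pdivrMr//.
have -> : e^-1 * (4^-1 * w) * kap = (w * kap / 4) / e by ring.
rewrite ler_pdivlMr//.
have h1 := ler_wpM2r m0 hk.
have h2 := ler_wpM2r (ltW e0) vm.
lra.
Qed.

(** The arrangement depends only on [u] and [A], so the representatives are fixed before [G] is
    drawn and a union bound over codes is legitimate. The three summands belong to [heavy],
    [starved] and [crowded]. *)
Lemma few_light_rows_event : 1 <= V -> 128 * V * expR 1 <= kap ->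
  exists E : set T, [/\ measurable E,
    pr P (~` E) <= (m * n)%:R * (2 * expR (- V ^+ 2 / 4)) +
      (m%:R * (4 * (2 * tau / kap)) ^+ n +
       ((m * k.+1).+1 ^ n.+1)%:R * (expR (- 1) ^+ n) ^+ K.+1) &
    forall w, E w -> few_light_rows u A (absmx G w) kap K%:R].
Proof.
move=> V1 hk.
have [rep repP] := cell_representatives cellmx cellcst.
have mh : forall ij : 'I_m * 'I_n, true -> measurable [set w | V <= `|G (ij.1, ij.2) w|].
  by move=> ij _; exact: (measurable_entry G _ _ (measurable_geray V)).
have ms : forall i : 'I_m, true -> measurable (light_row G (2 * tau / kap) i).
  by move=> i _; exact: measurable_light_row.
have mp J S : measurable (pattern G (thr rep J) (fun i => 8 * thr rep J i / kap) S).
  exact: measurable_pattern.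
have mc J : measurable (\big[setU/set0]_(S : {set 'I_m} | (K < #|S|)%N)
     pattern G (thr rep J) (fun i => 8 * thr rep J i / kap) S).
  by apply: bigsetU_measurable_fin => S _.
have mh' : measurable heavy by exact: bigsetU_measurable_fin.
have ms' : measurable starved by exact: bigsetU_measurable_fin.
have mc' : measurable (crowded rep) by apply: bigsetU_measurable_fin => J _.
have prU (X Y : set T) : measurable X -> measurable Y -> pr P (X `|` Y) <= pr P X + pr P Y.
  move=> mX mY; rewrite -lee_fin EFinD -!prE//; last exact: measurableU.
  exact: measureU2.
exists (~` (heavy `|` (starved `|` crowded rep))); split.
- by apply: measurableC; apply: measurableU => //; exact: measurableU.
- rewrite setCK; apply: (le_trans (prU _ _ mh' (measurableU _ _ ms' mc'))).
  apply: lerD; [|apply: (le_trans (prU _ _ ms' mc')); apply: lerD].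
  + apply: (le_trans (pr_bigsetU P mh)).
    apply: (@le_trans _ _ (\sum_(ij : 'I_m * 'I_n) (2 * expR (- V ^+ 2 / 4)))).
      apply: ler_sum => ij _.
      rewrite (pr_entry normG _ _ (measurable_geray V)) hprob_tail//.
      exact: le_trans V1.
    by rewrite sumr_const card_prod !card_ord -[leLHS]mulr_natl.
  + apply: (le_trans (pr_bigsetU P ms)).
    apply: (@le_trans _ _ (\sum_(i : 'I_m) (4 * (2 * tau / kap)) ^+ n)).
      apply: ler_sum => i _; apply: (pr_light_row_le n_gt0 indG normG).
      by rewrite divr_ge0 ?mulr_ge0 ?(ltW tau0) ?(ltW kap0).
    by rewrite sumr_const card_ord -[leLHS]mulr_natl.
  + apply: (le_trans (pr_bigsetU P (fun J _ => mc J))).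
    apply: (@le_trans _ _ (\sum_(J : code) (expR (- 1) ^+ n) ^+ K.+1)); last first.
      by rewrite sumr_const -[leLHS]mulr_natl card_code.
    (* The bound [thr rep J i <= V] is kept until [light_ratio] has been applied and dropped only
       for counting codes. *)
    apply: (@le_trans _ _ (\sum_(J : code | [forall i, thr rep J i <= V]) 
        (expR (- 1) ^+ n) ^+ K.+1)).
      apply: ler_sum => J /forallP JV.
      apply: (pr_patterns_le n_gt0 indG normG).
      * by rewrite exprn_ge0 ?expR_ge0//= exprn_ile1 ?expR_ge0// expR_le1// lerN10.
      * by move=> i; rewrite divr_ge0 ?mulr_ge0 ?thr_ge0// ltW.
      * by move=> i; apply: light_ratio => //; rewrite thr_ge0 JV.
    rewrite [leLHS]big_mkcond/=; apply: ler_sum => J _.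
    by case: ifP => _ //; rewrite !exprn_ge0 ?expR_ge0.
- move=> w /= /not_orP[h1 /not_orP[h2 h3]].
  exact: (few_light_rowsP repP).
Qed.

End LightRows.

(** * Affine policies *)

Section Rounding.
Variables (R : realType) (m n : nat).
Variables (U : set 'cV[R]_m) (u : 'I_m -> R).
Hypothesis U_bounds : forall h i, U h -> 0 <= h i 0 <= u i.
Implicit Types (l : seq 'cV[R]_m) (F : {set 'I_m}).

Definition covered l i : R := \sum_(b <- l) b i 0.

(** Potential argument: a scenario with uncovered relative demand above [th] raises [Phi] by more
    than [th], while [Phi <= 2 * #|F|]. The cap 2 is never exceeded by an uncovered row, whose ratio
    is below 1 and grows by at most 1. *)
Lemma greedy_cover F (th : R) : 0 < th ->
  exists l, [/\ forall b, b \in l -> U b,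
    (size l)%:R * th <= 2 * #|F|%:R &
    forall h, U h -> \sum_(i in F | covered l i < u i) h i 0 / u i <= th].
Proof.
move=> th0.
pose Phi l := \sum_(i in F) Num.min 2 (covered l i / u i).
have Phi_le l : Phi l <= 2 * #|F|%:R.
  rewrite -sum1_card natr_sum mulr_sumr; apply: ler_sum => i _.
  by rewrite mulr1 ge_min lexx.
(* Here [k] is fuel, measured by the remaining budget [2 * #|F| - size l * th]. *)
suff main k l : (forall b, b \in l -> U b) -> (size l)%:R * th <= Phi l ->
    2 * #|F|%:R - (size l)%:R * th < k%:R * th ->
    exists l, [/\ forall b, b \in l -> U b,
      (size l)%:R * th <= 2 * #|F|%:R &
      forall h, U h -> \sum_(i in F | covered l i < u i) h i 0 / u i <= th].
  have b0 := truncnS_gt (2 * #|F|%:R / th).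
  apply: (main (Num.truncn (2 * #|F|%:R / th)).+1 [::]) => //=.
    rewrite mul0r; apply: sumr_ge0 => i _.
    by rewrite /covered big_nil mul0r le_min lexx ler0n.
  by rewrite mul0r subr0 -ltr_pdivrMr.
elim: k l => [|k IH] l lU lP; first by have := Phi_le l; rewrite mul0r; lra.
move=> lk.
have [done|] := pselect (forall h, U h -> \sum_(i in F | covered l i < u i) h i 0 / u i <= th).
  by exists l; split=> //; exact: le_trans (Phi_le l).
move/existsNP => [h /not_implyP[Uh /negP]]; rewrite -ltNge => hth.
have covS i : covered (h :: l) i = h i 0 + covered l i by rewrite /covered big_cons.
have cov0 i : 0 <= covered l i.
  rewrite /covered big_seq; apply: sumr_ge0 => b /lU Ub.
  by have /andP[] := U_bounds i Ub.
apply: (IH (h :: l)).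
- by move=> b; rewrite inE => /predU1P[->//|/lU].
- have step : Phi l + th <= Phi (h :: l).
    apply: (le_trans (lerD (lexx _) (ltW hth))).
    rewrite big_mkcondr/= /Phi -big_split/=; apply: ler_sum => i _.
    have /andP[hi0 hiu] := U_bounds i Uh.
    have u0 : 0 <= u i by exact: le_trans hiu.
    rewrite covS; case: ifPn => [cu|_].
      have up : 0 < u i by exact: le_lt_trans cu.
      have h1 : h i 0 / u i <= 1 by rewrite ler_pdivrMr// mul1r.
      have h2 : covered l i / u i <= 1 by rewrite ler_pdivrMr// mul1r ltW.
      rewrite mulrDl !min_r; lra.
    rewrite addr0 le_min !ge_min lexx/= mulrDl; apply/orP; right.
    by rewrite lerDr divr_ge0.
  by rewrite /= -natr1 mulrDl mul1r; lra.
by move: lk; rewrite /= -!natr1 !mulrDl !mul1r; lra.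
Qed.

Variables (A B : 'M[R]_(m, n)) (x : 'cV[R]_n) (s t : R).
Variables (hmax : 'I_m -> 'cV[R]_m) (y : 'cV[R]_m -> 'cV[R]_n).
Hypotheses (A0 : mxnonneg A) (B0 : mxnonneg B) (x0 : mxnonneg x).
Hypotheses (s0 : 0 <= s) (t0 : 0 <= t).
Hypothesis hmaxU : forall i, U (hmax i).
Hypothesis hmaxE : forall i, hmax i i 0 = u i.
Hypothesis y_ge0 : forall h, U h -> mxnonneg (y h).
Hypothesis y_feas : forall h, U h -> mxle h (A *m x + B *m y h).
Hypothesis y_le : forall h, U h -> \sum_j y h j 0 <= s.

Lemma mulmx_nonneg (p q r : nat) (M : 'M[R]_(p, q)) (N : 'M[R]_(q, r)) :
  mxnonneg M -> mxnonneg N -> mxnonneg (M *m N).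
Proof.
move=> M0 N0 i j; rewrite !mxE; apply: sumr_ge0 => k _.
by have := M0 i k; have := N0 k j; rewrite !mxE => *; exact: mulr_ge0.
Qed.

(* Bertsimas-Goyal: rows outside F are served by the constant vector t; on F,
   realizations are piled up until every h in U has total relative demand at most th
   on the uncovered rows, which are then served linearly in h. *)
Lemma rounding_affine F (th : R) : 0 < th ->
  (forall i, i \notin F -> u i - (A *m x) i 0 <= t * \sum_j B i j) ->
  exists (K : nat) (P : 'M[R]_(n, m)) (q : 'cV[R]_n),
  [/\ K%:R * th <= 2 * #|F|%:R, aff_feasible A B U (K.+1%:R *: x) P q &
     forall h, U h -> \sum_j (P *m h + q) j 0 <= n%:R * t + (K%:R + th) * s].
Proof.
move=> th0 HF.
have [l [lU lK lth]] := greedy_cover F th0.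
pose I2 := [set i in F | covered l i < u i]%SET.
(* The linear part plays [y (hmax i)] scaled by [h_i / u_i] for every uncovered row [i]; the
   constant part [q] adds up the recourses of all scenarios in [l]. *)
pose P : 'M[R]_(n, m) := \matrix_(j, i) (if i \in I2 then y (hmax i) j 0 / u i else 0).
pose q : 'cV[R]_n := const_mx t + \sum_(b <- l) y b.
have zE h : P *m h + q = \sum_(i in I2) (h i 0 / u i) *: y (hmax i) + (const_mx t + \sum_(b <- l) y b).
  congr (_ + _); apply/matrixP => j k; rewrite [k]ord1 summxE [LHS]mxE [RHS]big_mkcond/=.
  under [RHS]eq_bigr => i _ do rewrite mxE.
  apply: eq_bigr => i _; rewrite mxE; case: ifP => _; last by rewrite mul0r.
  by rewrite mulrAC [RHS]mulrAC [h i 0 * _]mulrC.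
have hu h i : U h -> 0 <= h i 0 / u i <= 1.
  move=> /(U_bounds i)/andP[h1 h2]; have u0 := le_trans h1 h2.
  rewrite divr_ge0//=; move: u0; rewrite le_eqVlt => /predU1P[<-|up].
    by rewrite invr0 mulr0 ler01.
  by rewrite ler_pdivrMr// mul1r.
have Ax0 i : 0 <= (A *m x) i 0 by have := mulmx_nonneg A0 x0 i 0; rewrite mxE.
have By0 h i : U h -> 0 <= (B *m y h) i 0.
  by move=> Uh; have := mulmx_nonneg B0 (y_ge0 Uh) i 0; rewrite mxE.
have yf h i : U h -> h i 0 <= (A *m x) i 0 + (B *m y h) i 0.
  by move=> Uh; have := y_feas Uh i 0; rewrite [in leRHS]mxE.
have Bzt i : (B *m (const_mx t : 'cV_n)) i 0 = t * \sum_j B i j.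
  by rewrite mxE mulr_sumr; apply: eq_bigr => j _; rewrite mxE mulrC.
have BS0 i : 0 <= \sum_j B i j.
  by apply: sumr_ge0 => j _; have := B0 i j; rewrite mxE.
exists (size l), P, q; split=> //.
- split.
    by move=> j k; rewrite !mxE mulr_ge0//; have := x0 j k; rewrite mxE.
  move=> h Uh; rewrite zE; split; last first.
    move=> j k; rewrite !mxE !summxE addr_ge0//.
      apply: sumr_ge0 => i _; rewrite mxE; have /andP[h0 _] := hu h i Uh.
      by rewrite mulr_ge0//; have := y_ge0 (hmaxU i) j k; rewrite mxE.
    rewrite addr_ge0// big_seq; apply: sumr_ge0 => b /lU Ub.
    by have := y_ge0 Ub j k; rewrite mxE.
  move=> i k; rewrite [k]ord1 -scalemxAr !mulmxDr !mulmx_sumr.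
  rewrite [leRHS]mxE [X in X + _]mxE [X in _ + X]mxE [X in _ + (_ + X)]mxE Bzt !summxE.
  rewrite (eq_bigr (fun k => (h k 0 / u k) * (B *m y (hmax k)) i 0)); last first.
    by move=> k' _; rewrite -scalemxAr mxE.
  set T1 := \sum_(k in I2) _; set T3 := \sum_(b <- l) _.
  have T10 : 0 <= T1.
    by apply: sumr_ge0 => k' _; have /andP[h0 _] := hu h k' Uh; rewrite mulr_ge0// By0.
  have T30 : 0 <= T3 by rewrite /T3 big_seq; apply: sumr_ge0 => b /lU; exact: By0.
  have T20 : 0 <= t * \sum_j B i j by rewrite mulr_ge0.
  have a0 := Ax0 i; have /andP[hi0 hiu] := U_bounds i Uh.
  (* Of the [size l + 1] copies of [A x], one accompanies the constant vector or the linear part,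
     the others the scenarios in [l]. *)
  rewrite -natr1 mulrDl mul1r.
  have K0 : 0 <= (size l)%:R * (A *m x) i 0 by rewrite mulr_ge0.
  have [iF|iF] := boolP (i \in F); last by have := HF i iF; lra.
  have [iI2|iI2] := boolP (i \in I2).
    have h1 : h i 0 <= h i 0 / u i * ((A *m x) i 0 + (B *m y (hmax i)) i 0).
      have := yf _ i (hmaxU i); rewrite hmaxE => hy.
      have /andP[q0 q1] := hu h i Uh.
      apply: le_trans (ler_wpM2l q0 hy).
      move: iI2; rewrite inE => /andP[_ /(le_lt_trans _) up].
      rewrite divfK// gt_eqF//; apply: up; rewrite /covered big_seq.
      by apply: sumr_ge0 => b /lU Ub; have /andP[] := U_bounds i Ub.
    have h2 : h i 0 / u i * (A *m x) i 0 <= (A *m x) i 0.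
      by have /andP[q0 q1] := hu h i Uh; rewrite ler_piMl.
    have h3 : h i 0 / u i * (B *m y (hmax i)) i 0 <= T1.
      rewrite /T1 (bigD1 i)//= lerDl; apply: sumr_ge0 => k' _.
      by have /andP[h0 _] := hu h k' Uh; rewrite mulr_ge0// By0.
    by move: h1; rewrite mulrDr; lra.
  (* A covered row is served by the scenarios in [l], whose feasibility inequalities add up. *)
  have h1 : u i <= covered l i by move: iI2; rewrite inE iF /= -leNgt.
  have h2 : covered l i <= (size l)%:R * (A *m x) i 0 + T3.
    rewrite /covered /T3 -sum1_size natr_sum mulr_suml -big_split/= !big_seq.
    by apply: ler_sum => b /lU Ub; rewrite mul1r yf.
  lra.
move=> h Uh; rewrite zE.
under eq_bigr do rewrite !mxE !summxE.
rewrite !big_split/= sumr_const card_ord -[t *+ n]mulr_natl.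
have h3 : \sum_(j < n) \sum_(b <- l) y b j 0 <= (size l)%:R * s.
  rewrite exchange_big/= -sum1_size natr_sum mulr_suml !big_seq.
  by apply: ler_sum => b /lU Ub; rewrite mul1r y_le.
have h1 : \sum_(j < n) \sum_(i in I2) ((h i 0 / u i) *: y (hmax i)) j 0 <= th * s.
  rewrite exchange_big/=.
  apply: (@le_trans _ _ (\sum_(i in I2) h i 0 / u i * s)).
    apply: ler_sum => i _; under eq_bigr do rewrite mxE.
    have /andP[h0 _] := hu h i Uh.
    by rewrite -mulr_sumr ler_wpM2l// y_le.
  rewrite -mulr_suml ler_wpM2r//; apply: le_trans (lth h Uh).
  by rewrite le_eqVlt; apply/orP; left; apply/eqP; apply: eq_bigl => i; rewrite inE.
by rewrite mulrDl; lra.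
Qed.

End Rounding.

(** * Comparison of the adjustable and the affine optimal values *)

Lemma dotvZr (R : realType) n (c x : 'cV[R]_n) (a : R) : dotv c (a *: x) = a * dotv c x.
Proof. by rewrite /dotv mulr_sumr; apply: eq_bigr => i _; rewrite mxE mulrCA. Qed.

Lemma dotv_const (R : realType) n (a : R) (y : 'cV[R]_n) :
  dotv (a *: onesv n) y = a * \sum_j y j 0.
Proof. by rewrite /dotv mulr_sumr; apply: eq_bigr => i _; rewrite !mxE mulr1. Qed.

Lemma dotv_ge0 (R : realType) n (c x : 'cV[R]_n) : mxnonneg c -> mxnonneg x -> 0 <= dotv c x.
Proof.
move=> c0 x0; apply: sumr_ge0 => i _.
by have := c0 i 0; have := x0 i 0; rewrite !mxE => *; exact: mulr_ge0.
Qed.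

Lemma z_AR_le_z_Aff (R : realType) m n (A B : 'M[R]_(m, n)) c d U :
  (z_AR A B c d U <= z_Aff A B c d U)%E.
Proof.
apply: le_ereal_inf_tmp => _ [x [P [q [[x0 feas] ->]]]].
apply: ge_ereal_inf; exists ((dotv c x)%:E + ereal_sup [set second_stage A B d x h | h in U])%E.
  by exists x.
apply: leeD2l; apply: ge_ereal_sup => _ [h Uh <-].
have [f1 f2] := feas h Uh.
apply: (@le_trans _ _ (dotv d (P *m h + q))%:E).
  by apply: ereal_inf_lbound; exists (P *m h + q).
by apply: ereal_sup_ubound; exists h.
Qed.

Section Value.
Variables (R : realType) (m n : nat) (A B : 'M[R]_(m, n)) (c : 'cV[R]_n) (dbar : R).
Variables (U : set 'cV[R]_m) (u : 'I_m -> R) (hmax : 'I_m -> 'cV[R]_m).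
Variables (kap K th : R).
Hypotheses (m_gt0 : (0 < m)%N) (n_gt0 : (0 < n)%N).
Hypotheses (A0 : mxnonneg A) (B0 : mxnonneg B) (c0 : mxnonneg c) (dbar0 : 0 < dbar).
Hypothesis U_bounds : forall h i, U h -> 0 <= h i 0 <= u i.
Hypothesis hmaxU : forall i, U (hmax i).
Hypothesis hmaxE : forall i, hmax i i 0 = u i.
Hypotheses (kap0 : 0 < kap) (th0 : 0 < th) (K0 : 0 <= K).
Hypothesis few : few_light_rows u A B kap K.

(** The loss: [kap] for the constant policy, [2 * K / th] for the number of scenarios, [th] for the
    linear part, and 1 for the extra copy of [x]. The choice of [th] near [sqrt K] balances it. *)
Let Gam := 1 + kap + 2 * K / th + th.

Let Gam0 : 0 < Gam.
Proof.
have := divr_ge0 (mulr_ge0 (ler0n R 2) K0) (ltW th0); rewrite /Gam.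
by move: (_ / th) => z; have := kap0; have := th0; lra.
Qed.

Lemma affine_policy_cost (x : 'cV[R]_n) (s : R) (y : 'cV[R]_m -> 'cV[R]_n) :
  mxnonneg x -> 0 < s ->
  (forall h, U h -> [/\ mxnonneg (y h), mxle h (A *m x + B *m y h) & \sum_j y h j 0 <= s]) ->
  (z_Aff A B c (dbar *: onesv n) U <= (Gam * (dotv c x + dbar * s))%:E)%E.
Proof.
move=> x0 s0 yP.
have y0 h : U h -> mxnonneg (y h) by case/yP.
have yf h : U h -> mxle h (A *m x + B *m y h) by case/yP.
have ys h : U h -> \sum_j y h j 0 <= s by case/yP.
have nR : 0 < n%:R :> R by rewrite ltr0n.
pose F := [set i | kap / n%:R * (\sum_j B i j) < (u i - (A *m x) i 0) / s]%SET.
(* Otherwise the demand at [hmax i] would be positive, yet a recourse of total mass [s] would cover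
   at most half of it. *)
have big i : exists j, (u i - (A *m x) i 0) / (2 * s) <= B i j.
  apply: contrapT => /forallNP h.
  have hB j : B i j < (u i - (A *m x) i 0) / (2 * s) by rewrite ltNge; apply/negP; exact: h.
  set v := _ / _ in hB.
  have v0 : 0 < v.
    by apply: le_lt_trans (hB (Ordinal n_gt0)); have := B0 i (Ordinal n_gt0); rewrite mxE.
  have vE : u i - (A *m x) i 0 = 2 * (v * s) by rewrite /v; field; rewrite gt_eqF.
  have h1 : (B *m y (hmax i)) i 0 <= v * s.
    apply: le_trans (ler_wpM2l (ltW v0) (ys _ (hmaxU i))).
    rewrite mxE mulr_sumr; apply: ler_sum => j _; rewrite ler_wpM2r ?(ltW (hB j))//.
    by have := y0 _ (hmaxU i) j 0; rewrite mxE.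
  have h2 := yf _ (hmaxU i) i 0; rewrite hmaxE [leRHS]mxE in h2.
  have := mulr_gt0 v0 s0; lra.
have FK := few s0 big.
have t0 : 0 <= kap * s / n%:R by rewrite divr_ge0 ?mulr_ge0 ?ltW.
have HF i : i \notin F -> u i - (A *m x) i 0 <= kap * s / n%:R * \sum_j B i j.
  rewrite inE -leNgt ler_pdivrMr// => h; apply: le_trans h _.
  by rewrite le_eqVlt; apply/orP; left; apply/eqP; ring.
have [k [P [q [kF feas cost]]]] :=
  rounding_affine U_bounds A0 B0 x0 (ltW s0) t0 hmaxU hmaxE y0 yf ys th0 HF.
apply: (@le_trans _ _ ((dotv c (k.+1%:R *: x))%:E +
    ereal_sup [set (dotv (dbar *: onesv n) (P *m h + q))%:E | h in U])%E).
  by apply: ereal_inf_lbound; exists (k.+1%:R *: x), P, q.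
apply: (@le_trans _ _ ((dotv c (k.+1%:R *: x))%:E +
    (dbar * (n%:R * (kap * s / n%:R) + (k%:R + th) * s))%:E)%E).
  apply: leeD2l; apply: ge_ereal_sup => _ [h Uh <-].
  by rewrite lee_fin dotv_const ler_pM2l// cost.
rewrite -EFinD lee_fin dotvZr -natr1.
have -> : n%:R * (kap * s / n%:R) = kap * s by field; rewrite gt_eqF.
have cx0 := dotv_ge0 c0 x0.
have w0 := mulr_gt0 dbar0 s0.
have kK : k%:R <= 2 * K / th.
  by rewrite ler_pdivlMr//; apply: le_trans kF _; rewrite ler_pM2l.
rewrite /Gam; move: (dotv c x) cx0 (2 * K / th) kK => X X0 Z kZ.
have k0 : 0 <= k%:R :> R by [].
have -> : dbar * (kap * s + (k%:R + th) * s) = (kap + k%:R + th) * (dbar * s) by ring.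
move: (dbar * s) w0 => w w0.
have e1 : (1 + kap + Z + th) * (X + w) - ((k%:R + 1) * X + (kap + k%:R + th) * w) =
  (Z - k%:R) * X + kap * X + th * X + w + (Z - k%:R) * w by ring.
rewrite -subr_ge0 e1 !addr_ge0 ?mulr_ge0 ?subr_ge0 ?(ltW kap0) ?(ltW th0) ?(ltW w0)//.
Qed.

Lemma z_Aff_le : (z_Aff A B c (dbar *: onesv n) U <= Gam%:E * z_AR A B c (dbar *: onesv n) U)%E.
Proof.
rewrite -ereal_inf_pZl//; apply: le_ereal_inf_tmp => _ [_ [x x0 <-] <-].
have ss0 h : (0 <= second_stage A B (dbar *: onesv n) x h)%E.
  apply: le_ereal_inf_tmp => _ [y [y0 _] <-]; rewrite lee_fin dotv_const.
  rewrite mulr_ge0 ?(ltW dbar0)//; apply: sumr_ge0 => j _.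
  by have := y0 j 0; rewrite mxE.
have ssS h : U h -> (second_stage A B (dbar *: onesv n) x h <=
    ereal_sup [set second_stage A B (dbar *: onesv n) x h | h in U])%E.
  by move=> Uh; apply: ereal_sup_ubound; exists h.
have S0 := le_trans (ss0 _) (ssS _ (hmaxU (Ordinal m_gt0))).
move: S0 ssS; case: (ereal_sup _) => [s0| |//] S0 ssS; last first.
  by rewrite addey// gt0_muley ?lte_fin// leey.
apply/lee_addgt0Pr => e e0.
(* The slack makes [w] positive even if [s0 = 0], allows near-optimal recourses where no optimum is
   known to be attained, and becomes exactly [e] after multiplication by [Gam]. *)
set w := s0 + e / Gam.
have w0 : 0 < w by rewrite ltr_wpDl ?divr_gt0.
have /choice[y yP] : forall h, exists y, U h ->
    [/\ mxnonneg y, mxle h (A *m x + B *m y) & \sum_j y j 0 <= w / dbar].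
  move=> h; have [Uh|nU] := pselect (U h); last by exists 0.
  have : (second_stage A B (dbar *: onesv n) x h < w%:E)%E.
    by apply: le_lt_trans (ssS h Uh) _; rewrite lte_fin ltrDl divr_gt0.
  move=> /ereal_inf_lt[_ [y [y0 yf] <-]]; rewrite lte_fin dotv_const => yw.
  by exists y => _; split=> //; rewrite ler_pdivlMr// mulrC ltW.
apply: (le_trans (affine_policy_cost x0 (divr_gt0 w0 dbar0) yP)).
rewrite (_ : (_ + e%:E)%E = (Gam * (dotv c x + s0) + e)%:E) // lee_fin le_eqVlt; apply/orP; left; apply/eqP.
by rewrite /w; field; rewrite !gt_eqF.
Qed.

End Value.

(** The set contains 0 because [r >= 0], so the extreme value theorem yields a maximizer of each
    coordinate. *)
Lemma polyU_coordinate_max (R : realType) (L m : nat) (Rm : 'M[R]_(L, m)) (r : 'cV[R]_L) :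
  mxnonneg r -> compact (polyU Rm r) ->
  exists hmax : 'I_m -> 'cV[R]_m, (forall i, polyU Rm r (hmax i)) /\
    forall h i, polyU Rm r h -> 0 <= h i 0 <= hmax i i 0.
Proof.
move=> r0 cU.
have U0 : polyU Rm r !=set0.
  by exists 0; split=> i j; rewrite ?mulmx0 ?mxE//; have := r0 i j; rewrite mxE.
have /choice[hmax hP] : forall i, exists g, polyU Rm r g /\
    forall h, polyU Rm r h -> h i 0 <= g i 0.
  move=> i; have cc : {within polyU Rm r, continuous (fun h : 'cV[R]_m => h i 0)}.
    by apply: continuous_subspaceT => h; exact: coord_continuous.
  have [g gU gmax] := compact_EVT_max U0 cU cc.
  exists g; split; first by rewrite inE in gU.
  by move=> h Uh; apply: gmax; rewrite inE.
exists hmax; split=> [i|h i Uh]; first by have [] := hP i.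
apply/andP; split; last by have [_] := hP i; apply.
by have [h0 _] := Uh; have := h0 i 0; rewrite mxE.
Qed.

Unset Implicit Arguments.

(** * Numerical estimates for the chosen parameters *)

Lemma sqr8_le_exp2 (k : nat) : (10 <= k)%N -> (8 * k ^ 2 <= 2 ^ k)%N.
Proof.
elim: k => // k IH; rewrite leq_eqVlt => /predU1P[<-//|k10].
have := IH k10; rewrite [(2 ^ k.+1)%N]expnS -!mulnn; move: (2 ^ k)%N => a.
have : (2 * k + 1 <= k * k)%N by nia.
have -> : (k.+1 * k.+1 = k * k + (2 * k + 1))%N by rewrite mulSn mulnS; lia.
by move: (k * k)%N => z; lia.
Qed.

(** The number of codes for [k = m * n] levels: the base is at most [(m * n) ^ 3], and
    [3 * (n + 1) <= 6 * n]. *)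
Lemma cell_count_le (m n : nat) : (1 < m)%N -> (0 < n)%N ->
  ((m * (m * n).+1).+1 ^ n.+1 <= (m * n) ^ (6 * n))%N.
Proof.
move=> m1 n0.
have mM : (m <= m * n)%N by rewrite leq_pmulr.
have M2 : (2 <= m * n)%N by exact: leq_trans mM.
apply: (@leq_trans (((m * n) ^ 3) ^ n.+1)); last by rewrite -expnM leq_exp2l//; lia.
rewrite leq_exp2r// !expnS expn0 muln1; move: (m * n)%N M2 mM => M M2 mM.
apply: (@leq_ltn_trans (M * M.+1)%N); first by rewrite leq_mul2r mM orbT.
have : (2 * (M * M) <= M * (M * M))%N by rewrite leq_mul2r M2 orbT.
have : (2 * M <= M * M)%N by rewrite leq_mul2r M2 orbT.
by rewrite mulnS; move: (M * (M * M))%N (M * M)%N => z w; lia.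
Qed.

Section Numerics.
Variables (R : realType) (m n : nat).
Hypotheses (m16 : (16 <= m)%N) (n16 : (16 <= n)%N) (me : expR 1 <= m%:R :> R).
Let L : R := ln m%:R + ln n%:R.
Let X : R := (m * n)%:R.

Lemma expR_L : expR L = X.
Proof.
by rewrite expRD !lnK ?posrE ?ltr0n -?natrM//; lia.
Qed.

Lemma L_ge1 : 1 <= L.
Proof.
rewrite -ler_expR expR_L; apply: le_trans me _; rewrite ler_nat leq_pmulr//; lia.
Qed.

Lemma L_leX : L <= X.
Proof. by rewrite -expR_L; apply: le_trans (expR_ge1Dx L); rewrite lerDr. Qed.

(** This is the condition [V_le] for [V = 4 * sqrt L], [tau = 1 / m] and [k = m * n]. *)
Lemma threshold_range : 2 * (4 * Num.sqrt L) <= 2 ^+ (m * n) * m%:R^-1.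
Proof.
have L1 := L_ge1; have LX := L_leX.
have m0 : 0 < m%:R :> R by rewrite ltr0n; lia.
have sL : Num.sqrt L <= L.
  have L0 : 0 <= L by lra.
  have := sqr_sqrtr L0; have := sqrtr_ge0 L.
  move: (Num.sqrt L) => z z0 zE; rewrite -zE.
  have z1 : 1 <= z by rewrite leNgt; apply/negP => z1; nra.
  nra.
rewrite ler_pdivlMr//.
apply: (@le_trans _ _ (8 * X ^+ 2)); last first.
  by rewrite /X -!natrX -natrM ler_nat sqr8_le_exp2//; nia.
have mX : m%:R <= X by rewrite ler_nat leq_pmulr//; lia.
have : Num.sqrt L * m%:R <= X * X.
  by apply: ler_pM; rewrite ?sqrtr_ge0 ?(ltW m0) ?(le_trans sL).
by rewrite expr2; lra.
Qed.

(** The three terms are at most 2, 1 and 1 times [1 / m^2], and [4 <= m]. *)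
Lemma failure_bound (kap : R) (K : nat) : 8 <= kap -> 8 * L <= K.+1%:R ->
  X * (2 * expR (- (4 * Num.sqrt L) ^+ 2 / 4)) +
   (m%:R * (4 * (2 * m%:R^-1 / kap)) ^+ n +
    ((m * (m * n).+1).+1 ^ n.+1)%:R * (expR (- 1) ^+ n) ^+ K.+1) <= m%:R^-1.
Proof.
move=> kap8 K8.
have L1 := L_ge1; have LX := L_leX.
have m0 : 0 < m%:R :> R by rewrite ltr0n; lia.
have X0 : 0 < X by rewrite ltr0n; lia.
have mX : m%:R <= X by rewrite ler_nat leq_pmulr//; lia.
have m16R : 16 <= m%:R :> R by rewrite (ler_nat R 16).
have n16R : 16 <= n%:R :> R by rewrite (ler_nat R 16).
have X1 : 1 <= X by lra.
have expN (k : nat) : expR (- (k%:R * L)) = (X ^+ k)^-1.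
  by rewrite expRN expRM_natl expR_L.
have inv_le (k : nat) : (2 <= k)%N -> (X ^+ k)^-1 <= (m%:R ^+ 2)^-1.
  move=> k2; rewrite lef_pV2 ?posrE ?exprn_gt0//.
  apply: (@le_trans _ _ (X ^+ 2)); first by rewrite lerXn2r// nnegrE ltW.
  by rewrite ler_weXn2l.
have T1 : X * (2 * expR (- (4 * Num.sqrt L) ^+ 2 / 4)) <= 2 * (m%:R ^+ 2)^-1.
  rewrite exprMn sqr_sqrtr; last lra.
  have -> : - (4 ^+ 2 * L) / 4 = - (4%:R * L) by lra.
  rewrite expN mulrCA ler_pM2l//; apply: le_trans (inv_le 3 isT).
  by rewrite [X ^+ 4]exprS invfM mulrA divff ?mul1r// gt_eqF.
have T2 : m%:R * (4 * (2 * m%:R^-1 / kap)) ^+ n <= (m%:R ^+ 2)^-1.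
  have b0 : 0 <= m%:R^-1 :> R by rewrite invr_ge0.
  have b1 : m%:R^-1 <= 1 :> R by rewrite invf_le1//; lra.
  have h : 4 * (2 * m%:R^-1 / kap) <= m%:R^-1 :> R.
    have k0 : 0 < kap by lra.
    have -> : 4 * (2 * m%:R^-1 / kap) = 8 * m%:R^-1 / kap by ring.
    by rewrite ler_pdivrMr// mulrC ler_wpM2l.
  have h0 : 0 <= 4 * (2 * m%:R^-1 / kap).
    have k0 : 0 < kap by lra.
    by rewrite mulr_ge0// divr_ge0 ?(ltW k0)// mulr_ge0.
  apply: (@le_trans _ _ (m%:R * m%:R^-1 ^+ 3)).
    rewrite ler_pM2l//; apply: le_trans (_ : m%:R^-1 ^+ n <= _).
      by apply: lerXn2r; rewrite ?nnegrE.
    have n3 : (3 <= n)%N by apply: leq_trans n16.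
    exact: (ler_wiXn2l b0 b1 n3).
  by rewrite exprS mulrA divff ?gt_eqF// mul1r exprVn.
have T3 : ((m * (m * n).+1).+1 ^ n.+1)%:R * (expR (- 1) ^+ n) ^+ K.+1 <= (m%:R ^+ 2)^-1 :> R.
  have c1 : ((m * (m * n).+1).+1 ^ n.+1)%:R <= X ^+ (6 * n).
    rewrite /X -natrX ler_nat.
    by apply: cell_count_le; [exact: leq_trans m16|exact: leq_trans n16].
  (* As [K + 1 >= 8 * L] and [expR L = X], the decay [X ^ (- 8 n)] beats the cell count
     [X ^ (6 n)]. *)
  have c2 : (expR (- 1) ^+ n) ^+ K.+1 <= (X ^+ (8 * n))^-1.
    rewrite -exprM -expRM_natl mulrN1 -expN ler_expR lerN2 !natrM.
    by rewrite mulrAC mulrC ler_wpM2l.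
  apply: (@le_trans _ _ (X ^+ (6 * n) * (X ^+ (8 * n))^-1)).
    by apply: ler_pM => //; rewrite !exprn_ge0 ?expR_ge0.
  apply: le_trans (inv_le (2 * n)%N _); last by rewrite leq_pmulr// (leq_trans _ n16).
  have -> : (8 * n = 6 * n + 2 * n)%N by rewrite -mulnDl.
  by rewrite exprD invfM mulrA divff ?mul1r// expf_neq0// gt_eqF.
have : 4 * (m%:R ^+ 2)^-1 <= m%:R^-1 :> R.
  rewrite expr2 invfM mulrA -[leRHS]mul1r ler_pM2r ?invr_gt0//.
  by rewrite ler_pdivrMr//; lra.
lra.
Qed.

End Numerics.

Theorem theorem2 (R : realType) :
  exists (C : R) (N : nat), 0 < C /\
  forall (m n : nat), (0 < m)%N -> (0 < n)%N -> (N <= m)%N -> (N <= n)%N ->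
  forall (A : 'M[R]_(m, n)) (c : 'cV[R]_n) (dbar : R) (L : nat)
         (Rm : 'M[R]_(L, m)) (r : 'cV[R]_L),
    mxnonneg A -> mxnonneg c -> 0 < dbar -> mxnonneg Rm -> mxnonneg r ->
    compact (polyU Rm r) ->
  forall (dsp : measure_display) (T : measurableType dsp) (P : probability T R)
         (G : 'I_m * 'I_n -> {RV P >-> R}),
    mutually_independent P G ->
    (forall ij, distribution P (G ij) = normal_prob 0 1) ->
  exists E : set T, measurable E /\
    (P E >= (1 - (m%:R)^-1)%:E)%E /\
    forall w, E w ->
      let B := absmx G w in
      let d := dbar *: onesv n in
      (z_AR A B c d (polyU Rm r) <= z_Aff A B c d (polyU Rm r))%E /\
      (z_Aff A B c d (polyU Rm r)
         <= (C * Num.sqrt (ln m%:R + ln n%:R))%:E * z_AR A B c d (polyU Rm r))%E.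
Proof.
have e0 := expR_gt0 (1 : R).
have e1 : 1 <= expR (1 : R) by rewrite -[leLHS]expR0 ler_expR.
(* With [s] the square root of [ln m + ln n], [kap] is [128 * (4 * s) * expR 1] and the rest of the
   loss is at most [1 + 4 * s + 4 * s <= 9 * s]. The second summand of [N] ensures [m >= expR 1],
   hence [s >= 1]. *)
exists (512 * expR 1 + 9), (16 + (Num.truncn (expR (1 : R))).+1)%N.
split; first lra.
move=> m n m0 n0 mN nN A c dbar L Rm r A0 c0 dbar0 Rm0 r0 cU dsp T P G indG normG.
have m16 : (16 <= m)%N by apply: leq_trans mN; exact: leq_addr.
have n16 : (16 <= n)%N by apply: leq_trans nN; exact: leq_addr.
have me : expR 1 <= m%:R :> R.
  by apply/ltW/(lt_le_trans (truncnS_gt _)); rewrite ler_nat; apply: leq_trans mN; exact: leq_addl.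
have [hmax [hmaxU U_bounds]] := polyU_coordinate_max r0 cU.
have L1 := L_ge1 R m n m16 n16 me.
have rng := threshold_range R m n m16 n16 me.
have fb := failure_bound R m n m16 n16 me.
set l : R := ln m%:R + ln n%:R in L1 rng fb *.
have l0 : 0 <= l by lra.
have ls := sqr_sqrtr l0.
have s1 : 1 <= Num.sqrt l by rewrite -[leLHS]sqrtr1 ler_wsqrtr.
set s := Num.sqrt l in rng fb ls s1 *.
(* Both sides of the rounding are used: [K <= 8 * l] in the loss, [8 * l < K + 1] in the failure
   probability. *)
pose K := Num.truncn (8 * l).
have Kl : K%:R <= 8 * l by rewrite truncn_le mulr_ge0.
pose kap := 512 * expR 1 * s.
have es : 1 <= expR 1 * s by rewrite -[leLHS]mulr1 ler_pM.
have kap8 : 8 <= kap by rewrite /kap -mulrA; lra.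
have kap0 : 0 < kap by lra.
have th0 : 0 < 4 * s by lra.
have GamC : 1 + kap + 2 * K%:R / (4 * s) + 4 * s <= (512 * expR 1 + 9) * s.
  have Ks : 2 * K%:R / (4 * s) <= 4 * s.
    rewrite ler_pdivrMr//; have -> : 4 * s * (4 * s) = 16 * s ^+ 2 by ring.
    by rewrite ls; lra.
  by rewrite /kap mulrDl; lra.
have tau0 : 0 < m%:R^-1 :> R by rewrite invr_gt0 ltr0n.
have V1 : 1 <= 4 * s by lra.
have Vk : 128 * (4 * s) * expR 1 <= kap.
  by rewrite /kap le_eqVlt; apply/orP; left; apply/eqP; ring.
have [E [mE PE fewE]] := @few_light_rows_event _ _ _ P m n G n0 indG normG
  (fun i => hmax i i 0) A kap m%:R^-1 (4 * s) (m * n) K kap0 tau0 rng V1 Vk.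
exists E; split=> //; split.
  have PEC := le_trans PE (fb kap K kap8 (ltW (truncnS_gt _))).
  have : (P (~` E) <= (m%:R^-1)%:E)%E by rewrite prE ?lee_fin//; exact: measurableC.
  by rewrite probability_setC// prE// -EFinB !lee_fin => h; rewrite lerBlDr -lerBlDl.
move=> w Ew B d; split; first exact: z_AR_le_z_Aff.
have B0 : mxnonneg B by move=> i j; rewrite !mxE.
apply: le_trans (@z_Aff_le R m n A B c dbar _ _ hmax kap K%:R (4 * s) m0 n0 A0 B0 c0 dbar0
  U_bounds hmaxU (fun=> erefl) kap0 th0 (ler0n _ _) (fewE w Ew)) _.
(* Nonnegativity allows the loss factor to be enlarged to the stated constant. *)
have zAR0 : (0 <= z_AR A B c d (polyU Rm r))%E.
  apply: le_ereal_inf_tmp => _ [x x0 <-].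
  apply: adde_ge0; first by rewrite lee_fin dotv_ge0.
  apply: le_trans (ereal_sup_ubound (_ : [set second_stage A B d x h | h in polyU Rm r] _)).
    2: by exists (hmax (Ordinal m0)) => //.
  apply: le_ereal_inf_tmp => _ [y [y0 _] <-]; rewrite lee_fin.
  by apply: dotv_ge0 => // i j; rewrite !mxE mulr1 ltW.
by apply: lee_wpmul2r.
Qed.
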